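(* Let $(E_1,\|\cdot\|_1)$ and $(E_2,\|\cdot\|_2)$ be complex Banach spaces, and for $j=1,2$ let $B_j=\{x\in E_j \mid \|x\|_j<1\}$. Let $f\colon B_1\to B_2$ be a holomorphic map with $f(0)=0$ and $\|f'(0)(X)\|_2=\|X\|_1$ for all $X\in E_1$. Then the following statements are equivalent: (1) there exists a direct decomposition $E_2=f'(0)(E_1)\oplus F$ such that the corresponding projection $\pi\colon E_2\to f'(0)(E_1)$ has norm $1$; (2) $f(B_1)$ is a closed complex direct submanifold of $B_2$, the map $f$ is a biholomorphism of $B_1$ onto $f(B_1)$, and there exists a holomorphic retraction of $B_2$ onto $f(B_1)$.
   Context: Holomorphic means complex Fréchet differentiable on an open subset of a complex Banach space; $f'(a)$ denotes the (continuous, complex-linear) differential of $f$ at $a$. A direct decomposition $E_2=G\oplus F$ means that $G$ and $F$ are closed complex linear subspaces with $G\cap F=\{0\}$ and $G+F=E_2$; the corresponding projection $\pi\colon E_2\to G$ is the continuous linear projection with image $G$ and kernel $F$, and its norm is the operator norm with respect to $\|\cdot\|_2$. A closed complex direct submanifold $M$ of an open set $U\subseteq E_2$ is a relatively closed subset $M\subseteq U$ such that near each of its points there is a biholomorphic chart of $U$ taking $M$ to an open piece of a closed complemented complex linear subspace of $E_2$ (complemented meaning that it has a closed complementary subspace). A holomorphic retraction of $B_2$ onto $f(B_1)$ is a holomorphic map $r\colon B_2\to B_2$ with $r(B_2)=f(B_1)$ and $r(x)=x$ for all $x\in f(B_1)$.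
   Formalization: The space E_1 is assumed to be nonzero: for E_1 = {0} the map f is 0, statement (2) holds, but the projection onto {0} has norm 0, so statement (1) fails. *)

(* Defs.v *)
From HB Require Import structures.
From mathcomp Require Import all_boot all_order all_algebra.
From mathcomp Require Import all_classical all_reals all_analysis.
From mathcomp Require Import complex.

Set Implicit Arguments.
Unset Strict Implicit.
Unset Printing Implicit Defensive.

Import Order.TTheory GRing.Theory Num.Theory.
Import numFieldNormedType.Exports.

Local Open Scope ring_scope.
Local Open Scope classical_set_scope.

Section Holomorphy.
Context {R : realType}.
Implicit Types E F : completeNormedModType R[i].

(* The order of R[i] compares complex numbers with equal imaginary parts, so on
   norms it is the usual order of the reals. *)
Definition unit_ball E : set E := [set x | `|x| < 1].

(* Partial maps are represented by total functions whose values off the domain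
   are irrelevant; U is meant to be open. *)
Definition holomorphic E F (U : set E) (f : E -> F) : Prop :=
  forall x, U x -> differentiable f x.

Definition closed_subspace E (L : set E) : Prop :=
  closed L /\ submod_closed (mem L).

Definition direct_decomposition E (G F : set E) : Prop :=
  [/\ closed_subspace G, closed_subspace F, G `&` F = [set 0]
    & [set x + y | x in G & y in F] = setT].

Definition complemented E (L : set E) : Prop :=
  exists F : set E, direct_decomposition L F.

Definition projection_onto_along E (p : {linear E -> E}) (G F : set E) : Prop :=
  [/\ continuous p, forall x, p (p x) = p x, range p = G
    & p @^-1` [set 0] = F].

(* Only meaningful for continuous linear maps: the sup of an unbounded set of
   reals is 0 by convention. *)
Definition operator_norm E F (u : {linear E -> F}) : R :=
  sup [set complex.Re `|u x| | x in [set x : E | `|x| <= 1]].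

Definition biholomorphic E F (W : set E) (V : set F)
    (phi : E -> F) (psi : F -> E) : Prop :=
  [/\ open W /\ open V,
      holomorphic W phi /\ holomorphic V psi,
      set_fun W V phi /\ set_fun V W psi,
      {in W, cancel phi psi}
    & {in V, cancel psi phi}].

(* phi : W -> V, with inverse psi, is a biholomorphic chart of U that carries M
   to an open piece of the closed complemented subspace L. *)
Definition submanifold_chart E (U M W V : set E) (phi psi : E -> E)
    (L : set E) : Prop :=
  [/\ W `<=` U, biholomorphic W V phi psi,
      closed_subspace L, complemented L
    & phi @` (W `&` M) = V `&` L].

Definition closed_direct_submanifold E (U M : set E) : Prop :=
  (exists2 C : set E, closed C & M = U `&` C) /\
  forall p, M p -> exists (W V : set E) (phi psi : E -> E) (L : set E),
    W p /\ submanifold_chart U M W V phi psi L.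

(* Complex Frechet differentiability at a of a map defined on a neighbourhood of
   a in the Banach space L (a closed subspace of E); the values of D off L are
   irrelevant. *)
Definition differentiable_in_subspace E F (L : set E) (h : E -> F) (a : E) :
    Prop :=
  exists D : E -> F,
    [/\ {within L, continuous D},
        forall (c : R[i]) x y, L x -> L y -> D (c *: x + y) = c *: D x + D y
      & (fun x => h x - h a - D (x - a)) =o_ (within L (nbhs a))
        (fun x => x - a)].

(* Since closed subspaces inherit their topology, differentiability of phi \o f
   as a map into L amounts to differentiability into E2. *)
Definition holomorphic_to_submanifold E1 E2 (A : set E1) (U M : set E2)
    (f : E1 -> E2) : Prop :=
  [/\ set_fun A M f, {in A, continuous f}
    & forall W V phi psi L, submanifold_chart U M W V phi psi L ->
        holomorphic (A `&` f @^-1` W) (phi \o f)].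

Definition holomorphic_from_submanifold E1 E2 (U M : set E2) (A : set E1)
    (g : E2 -> E1) : Prop :=
  set_fun M A g /\
  forall W V phi psi L, submanifold_chart U M W V phi psi L ->
    forall y, (V `&` L) y -> differentiable_in_subspace L (g \o psi) y.

(* M is a submanifold of U; A is open. *)
Definition biholomorphism_onto_submanifold E1 E2 (A : set E1) (U M : set E2)
    (f : E1 -> E2) : Prop :=
  exists g : E2 -> E1,
    [/\ holomorphic_to_submanifold A U M f,
        holomorphic_from_submanifold U M A g,
        {in A, cancel f g} & {in M, cancel g f}].

Definition holomorphic_retraction E (U M : set E) (r : E -> E) : Prop :=
  [/\ holomorphic U r, set_fun U U r, r @` U = M & forall x, M x -> r x = x].

End Holomorphy.

Arguments unit_ball {R} E _.

(* Main.v *)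
Require Import Defs.
From HB Require Import structures.
From mathcomp Require Import all_boot all_order all_algebra.
From mathcomp Require Import all_classical all_reals all_analysis.
From mathcomp Require Import complex.
From mathcomp Require Import ring lra zify.

(* Cartan's uniqueness theorem gives (1) => (2): with [g] the composition of
   [pi] and the inverse of [f'(0)], the map [g o f] fixes [0] with differential
   the identity, so [g o f = id] on the ball; then [f o g] is a retraction, and
   [y |-> y - (f (g y) - f'(0) (g y))] is a global chart flattening the image.
   Conversely, if [r] is a retraction, then [r'(0)] is a projection onto the
   range of [f'(0)], of norm [1] by the Schwarz lemma.

   The one-variable theory behind both is obtained without integrals.
   Trapezoidal sums of [G dz] along the boundary of dyadic squares are additive
   under subdivision and vanish exactly on affine [G], so Goursat's bisection
   applies to them and yields homotopy invariance up to [o(1)] in the mesh, and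
   Cauchy's formula as a limit of means over the [2 ^ N]-th roots of unity. *)

Set Implicit Arguments.
Unset Strict Implicit.
Unset Printing Implicit Defensive.

Import Order.TTheory GRing.Theory Num.Theory.
Import numFieldNormedType.Exports.

Local Open Scope ring_scope.
Local Open Scope classical_set_scope.
Local Open Scope complex_scope.

(** * Real-valued norms *)

(** Without integrals, Cauchy's formula is never an equality here: every statement about means has
    the form [<= e] for all large [N], and the limit is taken only in the last inequality of the
    Schwarz estimate. Cauchy's formula asks only for continuity at the exceptional point, so it also
    applies at [0] to [H z / z ^ k], and this replaces power series. Likewise no higher derivatives
    occur. Vanishing of a map to order [m] is stated as [o(|x| ^ m)], and Schwarz's lemma on complex
    lines turns it, for a bounded map, into [O(|x| ^ (m + 1))] with a constant that depends on the
    bound and on [m] alone. Cartan's theorem needs this uniformity because it is applied to all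
    iterates of one map. In the converse direction the inverse of [f] is holomorphic only as read in
    charts of the image. All that is extracted from it is continuity at [0], which places [r'(0) v]
    in the closure of the range of [f'(0)]; the range is closed because [f'(0)] is isometric. *)

Section RealNorm.
Context {R : realType}.

(** Norms take values in [R[i]], whose order is partial; taking the real part moves estimates to
    [R], where [lra] and [nra] apply. *)
Definition rnorm (V : normedZmodType R[i]) (x : V) : R := complex.Re `|x|.

Lemma normE (V : normedZmodType R[i]) (x : V) : `|x| = (rnorm x)%:C.
Proof. by rewrite /rnorm RRe_real // ger0_real. Qed.

Lemma rnorm_ge0 (V : normedZmodType R[i]) (x : V) : 0 <= rnorm x.
Proof. by rewrite -ler0c -normE. Qed.

Lemma rnorm_lt (V : normedZmodType R[i]) (x : V) (e : R) :
  (`|x| < e%:C) = (rnorm x < e).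
Proof. by rewrite normE ltcR. Qed.

Lemma rnorm_le (V : normedZmodType R[i]) (x : V) (e : R) :
  (`|x| <= e%:C) = (rnorm x <= e).
Proof. by rewrite normE lecR. Qed.

Lemma rnormD (V : normedZmodType R[i]) (x y : V) :
  rnorm (x + y) <= rnorm x + rnorm y.
Proof. by rewrite -lecR rmorphD /= -!normE ler_normD. Qed.

Lemma rnormN (V : normedZmodType R[i]) (x : V) : rnorm (- x) = rnorm x.
Proof. by rewrite /rnorm normrN. Qed.

Lemma rnormB (V : normedZmodType R[i]) (x y : V) :
  rnorm (x - y) <= rnorm x + rnorm y.
Proof. by rewrite -(rnormN y) rnormD. Qed.

Lemma rdistC (V : normedZmodType R[i]) (x y : V) : rnorm (x - y) = rnorm (y - x).
Proof. by rewrite /rnorm distrC. Qed.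

Lemma rnorm0 (V : normedZmodType R[i]) : rnorm (0 : V) = 0.
Proof. by rewrite /rnorm normr0. Qed.

Lemma rnorm_eq0 (V : normedZmodType R[i]) (x : V) : (rnorm x == 0) = (x == 0).
Proof. by rewrite -[RHS]normr_eq0 normE -[0 in RHS](rmorph0 (real_complex R))
  (inj_eq (@complexI R)). Qed.

Lemma rnorm_gt0 (V : normedZmodType R[i]) (x : V) : (0 < rnorm x) = (x != 0).
Proof. by rewrite lt_def rnorm_eq0 rnorm_ge0 andbT. Qed.

Lemma rnorm_sum (V : normedZmodType R[i]) I (r : seq I) (P : pred I) (F : I -> V) :
  rnorm (\sum_(i <- r | P i) F i) <= \sum_(i <- r | P i) rnorm (F i).
Proof.
elim/big_ind2: _ => [|x a y b xa yb|//]; first by rewrite rnorm0.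
by rewrite (le_trans (rnormD _ _)) ?lerD.
Qed.

Lemma rnorm_triB (V : normedZmodType R[i]) (x y : V) :
  rnorm x <= rnorm y + rnorm (x - y).
Proof. by rewrite -{1}(subrKC y x) rnormD. Qed.

Lemma rnormM (a b : R[i]) : rnorm (a * b) = rnorm a * rnorm b.
Proof. by apply: (@complexI R); rewrite rmorphM /= -!normE normrM. Qed.

Lemma rnormZ (E : normedModType R[i]) (a : R[i]) (x : E) :
  rnorm (a *: x) = rnorm a * rnorm x.
Proof. by apply: (@complexI R); rewrite rmorphM /= -!normE normrZ. Qed.

Lemma rnorm1 : rnorm (1 : R[i]) = 1.
Proof. by rewrite /rnorm normr1. Qed.

Lemma rnormX (a : R[i]) n : rnorm (a ^+ n) = rnorm a ^+ n.
Proof. by elim: n => [|n IH]; rewrite ?expr0 ?rnorm1 // !exprS rnormM IH. Qed.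

Lemma rnormV (a : R[i]) : rnorm (a^-1) = (rnorm a)^-1.
Proof. by apply: (@complexI R); rewrite fmorphV /= -!normE normfV. Qed.

Lemma rnormC (r : R) : rnorm (r%:C) = `|r|.
Proof.
by rewrite /rnorm normc_def /= expr0n addr0 sqrtr_sqr.
Qed.

Lemma rnorm_nat n : rnorm (n%:R : R[i]) = n%:R.
Proof. by rewrite -(rmorph_nat (real_complex R)) rnormC ger0_norm. Qed.

End RealNorm.

(** * Goursat by trapezoidal sums *)

Section Bisection.
Context {R : realType}.

(** The second hypothesis makes each dyadic interval one of the two halves of the preceding one; the
    common point is the supremum of the left ends. *)
Lemma nested_dyadic_point (a : nat -> nat) : a 0%N = 0%N ->
  (forall k, (2 * a k <= a k.+1 < 2 * a k + 2)%N) ->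
  exists2 x : R, 0 <= x <= 1
    & forall k, (a k)%:R / 2 ^+ k <= x <= (a k).+1%:R / 2 ^+ k.
Proof.
move=> a0 aS; have pos2 k : (0 : R) < 2 ^+ k by rewrite exprn_gt0.
pose l k : R := (a k)%:R / 2 ^+ k; pose u k : R := (a k).+1%:R / 2 ^+ k.
have lS k : l k <= l k.+1.
  have /andP[+ _] := aS k.
  rewrite -(ler_nat R) natrM /l ler_pdivrMr // mulrAC ler_pdivlMr // exprS.
  by move=> h; rewrite mulrA ler_pM2r // mulrC.
have uS k : u k.+1 <= u k.
  have /andP[_ +] := aS k; rewrite addn2 ltnS -(ler_nat R) => h.
  rewrite /u ler_pdivrMr // mulrAC ler_pdivlMr // exprS mulrA ler_pM2r //.
  move: h; rewrite -!natr1 natrM; lra.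
have lu k : l k <= u k by rewrite ler_pM2r ?invr_gt0 // ler_nat.
have ll j k : (j <= k)%N -> l j <= l k.
  by move/subnK<-; elim: (k - j)%N => // n IH; rewrite addSn (le_trans IH).
have uu j k : (j <= k)%N -> u k <= u j.
  by move/subnK<-; elim: (k - j)%N => // n IH; rewrite addSn (le_trans _ IH).
have lju j k : l j <= u k.
  have [jk|/ltnW kj] := leqP j k; first by rewrite (le_trans (ll _ _ jk)).
  by rewrite (le_trans (lu j)) ?uu.
have l0 : l 0%N = 0 by rewrite /l a0 mul0r.
have u0 : u 0%N = 1 by rewrite /u a0 expr0 divr1.
have sl : has_sup (range l).
  by split; [exists (l 0%N), 0%N | exists (u 0%N) => _ [j _ <-]].
have lx k : l k <= sup (range l) by apply: sup_upper_bound => //; exists k.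
have xu k : sup (range l) <= u k.
  by apply: ge_sup => [|_ [j _ <-]]; [exists (l 0%N), 0%N|].
exists (sup (range l)) => [|k]; first by rewrite -{1}l0 -u0 lx xu.
by rewrite lx xu.
Qed.

(** Compactness of the unit square as an induction principle: if [P] failed on the whole square,
    choosing a failing quarter again and again would give squares shrinking to a point, near which
    [P] holds. *)
Lemma dyadic_square_ind (P : nat -> nat -> nat -> Prop) :
  (forall k a b,
     (forall i j : bool, P k.+1 (2 * a + i)%N (2 * b + j)%N) -> P k a b) ->
  (forall x y : R, 0 <= x <= 1 -> 0 <= y <= 1 -> exists k0, forall k a b,
     (k0 <= k)%N -> (a < 2 ^ k)%N -> (b < 2 ^ k)%N ->
     a%:R / 2 ^+ k <= x <= a.+1%:R / 2 ^+ k ->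
     b%:R / 2 ^+ k <= y <= b.+1%:R / 2 ^+ k -> P k a b) ->
  P 0%N 0%N 0%N.
Proof.
move=> PS Ploc; apply: contrapT => P0.
have /choice[c cP] : forall t : nat * (nat * nat), exists ij : bool * bool,
    ~ P t.1 t.2.1 t.2.2 -> ~ P t.1.+1 (2 * t.2.1 + ij.1)%N (2 * t.2.2 + ij.2)%N.
  move=> [k [a b]] /=; apply: contrapT => /forallNP h.
  apply: (h (true, true)) => /= nP; case: nP; apply: PS => i j.
  by apply: contrapT => nP'; apply: (h (i, j)).
pose s := fix s k : nat * nat := if k is k'.+1 then
  ((2 * (s k').1 + (c (k', s k')).1)%N, (2 * (s k').2 + (c (k', s k')).2)%N)
  else (0%N, 0%N).
have sP k : ~ P k (s k).1 (s k).2 by elim: k => //= k IH; apply: (cP (k, s k)).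
have s1 k : (2 * (s k).1 <= (s k.+1).1 < 2 * (s k).1 + 2)%N.
  by rewrite /= leq_addr ltn_add2l; case: (c _).1.
have s2 k : (2 * (s k).2 <= (s k.+1).2 < 2 * (s k).2 + 2)%N.
  by rewrite /= leq_addr ltn_add2l; case: (c _).2.
have lt1 k : ((s k).1 < 2 ^ k)%N.
  by elim: k => // k IH; have := s1 k; rewrite expnS; lia.
have lt2 k : ((s k).2 < 2 ^ k)%N.
  by elim: k => // k IH; have := s2 k; rewrite expnS; lia.
have [x x01 xs] := @nested_dyadic_point (fun k => (s k).1) erefl s1.
have [y y01 ys] := @nested_dyadic_point (fun k => (s k).2) erefl s2.
have [k0 k0P] := Ploc x y x01 y01.
exact/(sP k0)/k0P.
Qed.

End Bisection.

Section Circulation.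
Context {E : zmodType}.
Implicit Types (h v W : nat -> nat -> E).

(** [h p q] lives on the edge from [(p, q)] to [(p + 1, q)] and [v p q] on the edge from [(p, q)] to
    [(p, q + 1)]; the sum runs counterclockwise around the rectangle. *)
Definition circulation h v (p0 p1 q0 q1 : nat) : E :=
  \sum_(p0 <= p < p1) (h p q0 - h p q1) + \sum_(q0 <= q < q1) (v p1 q - v p0 q).

Lemma circulation_splitl h v p0 p1 p2 q0 q1 : (p0 <= p1 <= p2)%N ->
  circulation h v p0 p2 q0 q1 =
    circulation h v p0 p1 q0 q1 + circulation h v p1 p2 q0 q1.
Proof.
move=> /andP[p01 p12]; rewrite /circulation (big_cat_nat p01 p12) /=.
rewrite addrACA -big_split /=; congr (_ + _); apply: eq_bigr => q _.
by rewrite [RHS]addrC subrKA.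
Qed.

Lemma circulation_splitr h v p0 p1 q0 q1 q2 : (q0 <= q1 <= q2)%N ->
  circulation h v p0 p1 q0 q2 =
    circulation h v p0 p1 q0 q1 + circulation h v p0 p1 q1 q2.
Proof.
move=> /andP[q01 q12]; rewrite /circulation (big_cat_nat q01 q12) /=.
rewrite [RHS]addrACA -big_split /=; congr (_ + _); apply: eq_bigr => p _.
by rewrite subrKA.
Qed.

(** Increments of a function of the vertices telescope along each side, and the corner values
    cancel. *)
Lemma circulation_exact W p0 p1 q0 q1 : (p0 <= p1)%N -> (q0 <= q1)%N ->
  circulation (fun p q => W p.+1 q - W p q) (fun p q => W p q.+1 - W p q)
    p0 p1 q0 q1 = 0.
Proof.
move=> p01 q01; rewrite /circulation.
rewrite (telescope_sumr_eq (fun p => W p q0 - W p q1)) // => [|p _]; last first.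
  by rewrite !opprD !opprK addrACA.
rewrite (telescope_sumr_eq (fun q => W p1 q - W p0 q)) // => [|q _]; last first.
  by rewrite !opprD !opprK addrACA.
apply/eqP; rewrite -[X in _ + X]opprB subr_eq0; apply/eqP.
by rewrite !opprD !opprK addrACA.
Qed.

Lemma circulationD h v h' v' p0 p1 q0 q1 :
  circulation (fun p q => h p q + h' p q) (fun p q => v p q + v' p q)
    p0 p1 q0 q1 = circulation h v p0 p1 q0 q1 + circulation h' v' p0 p1 q0 q1.
Proof.
rewrite /circulation addrACA -!big_split /=.
by congr (_ + _); apply: eq_bigr => i _; rewrite opprD addrACA.
Qed.

End Circulation.

Section Goursat.
Context {R : realType}.
Implicit Types (E : normedModType R[i]).

(** A square of side [m] has [4 * m] boundary edges. *)
Lemma circulation_bound E (h v : nat -> nat -> E) (B : R) m p q :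
  (forall i j, (p <= i < p + m)%N -> (q <= j <= q + m)%N -> rnorm (h i j) <= B) ->
  (forall i j, (p <= i <= p + m)%N -> (q <= j < q + m)%N -> rnorm (v i j) <= B) ->
  rnorm (circulation h v p (p + m) q (q + m)) <= 4 * m%:R * B.
Proof.
move=> hB vB; rewrite /circulation (le_trans (rnormD _ _)) //.
have -> : 4 * m%:R * B = 2 * B *+ m + 2 * B *+ m by rewrite -(mulr_natr (2 * B)); ring.
have bnd (F : nat -> E) s : (forall i, (s <= i < s + m)%N -> rnorm (F i) <= 2 * B) ->
    rnorm (\sum_(s <= i < s + m) F i) <= 2 * B *+ m.
  move=> FB; rewrite (le_trans (rnorm_sum _ _ _)) //.
  rewrite -[X in _ *+ X](addKn s) -sumr_const_nat big_nat [leRHS]big_nat.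
  exact: ler_sum.
apply: lerD; apply: bnd => i /[dup] /andP[i0 i1] i01;
  rewrite (le_trans (rnormB _ _)) // mulr_natl mulr2n lerD //.
- by apply: hB; rewrite // leqnn leq_addr.
- by apply: hB; rewrite // leqnn leq_addr.
- by apply: vB; rewrite // leqnn leq_addr.
- by apply: vB; rewrite // leqnn leq_addr.
Qed.

Definition ccont (E : normedZmodType R[i]) (D : R[i] -> E) (z : R[i]) : Prop :=
  forall e : R, 0 < e -> exists2 d : R, 0 < d
    & forall w, rnorm (w - z) < d -> rnorm (D w - D z) < e.

(* Caratheodory's form of complex differentiability. *)
Definition cdiff E (H : R[i] -> E) (z : R[i]) : Prop :=
  exists2 D : R[i] -> E, ccont D z & forall w, H w = H z + (w - z) *: D w.

(* Twice the trapezoid rule for [G dz] on the segment from [z] to [w]. *)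
Definition trapezoid E (G : R[i] -> E) (z w : R[i]) : E :=
  (w - z) *: (G z + G w).

Definition grid_circulation E (G : R[i] -> E) (z : R -> R -> R[i]) N :=
  let P p q := z (p%:R / 2 ^+ N) (q%:R / 2 ^+ N) in
  circulation (fun p q => trapezoid G (P p q) (P p.+1 q))
              (fun p q => trapezoid G (P p q) (P p q.+1)).

(* Up to an error controlled by the oscillation of [D] near [c], the trapezoid
   rule is the increment of the primitive [W]. *)
Lemma trapezoid_expand E (G D : R[i] -> E) (c z w : R[i]) :
  (forall w, G w = G c + (w - c) *: D w) ->
  let W z := (z - c) *: (G c *+ 2) + (z - c) ^+ 2 *: D c in
  trapezoid G z w = (W w - W z) +
    (w - z) *: ((z - c) *: (D z - D c) + (w - c) *: (D w - D c)).
Proof.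
move=> GD W; rewrite /trapezoid (GD z) (GD w) /W.
set a := z - c; set b := w - c; have -> : w - z = b - a by rewrite /a /b; ring.
have scalB (X Y : E) : b *: X + b ^+ 2 *: Y - (a *: X + a ^+ 2 *: Y) =
    (b - a) *: (X + (a + b) *: Y).
  rewrite opprD addrACA -!scalerBl scalerDr scalerA.
  by congr (_ + _ *: _); ring.
rewrite scalB -scalerDr addrACA -mulr2n -[X in _ = _ *: X]addrA.
congr (_ *: (_ + _)); by rewrite [(a + b) *: _]scalerDl [RHS]addrACA !scalerBr !subrKC.
Qed.

(** The Lipschitz bound on [z] gives the image of a square of side [1 / 2 ^ k] a diameter and a
    polygonal perimeter of order [L / 2 ^ k]. The errors of [trapezoid_expand] then add up to a
    small multiple of [L ^ 2 / 4 ^ k], proportional to the area of the square. *)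
Lemma goursat_grid E (G : R[i] -> E) (z : R -> R -> R[i]) (L : R) :
  0 <= L ->
  (forall x y x' y', 0 <= x <= 1 -> 0 <= y <= 1 -> 0 <= x' <= 1 -> 0 <= y' <= 1 ->
     rnorm (z x y - z x' y') <= L * (`|x - x'| + `|y - y'|)) ->
  (forall x y, 0 <= x <= 1 -> 0 <= y <= 1 -> cdiff G (z x y)) ->
  forall e : R, 0 < e -> exists N0, forall N, (N0 <= N)%N ->
    rnorm (grid_circulation G z N 0 (2 ^ N) 0 (2 ^ N)) <= e.
Proof.
move=> L0 zL Gd e e0.
pose Q N k a b m :=
  rnorm (grid_circulation G z N (a * m) (a * m + m) (b * m) (b * m + m))
    <= e / 4 ^+ k.
(* The allowance [e / 4 ^ k] is the sum of those of the four quarters. The threshold [N0] may depend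
   on the square, since only four thresholds are ever combined at once. *)
pose P k a b := exists2 N0, (k <= N0)%N &
  forall N, (N0 <= N)%N -> Q N k a b (2 ^ (N - k))%N.
suff [N0 _ N0P] : P 0%N 0%N 0%N.
  by exists N0 => N /N0P; rewrite /Q !mul0n !add0n subn0 divr1.
apply: (@dyadic_square_ind R) => [k a b PS|x y x01 y01].
  have [N00 k00 h00] := PS false false; have [N01 k01 h01] := PS false true.
  have [N10 k10 h10] := PS true false; have [N11 k11 h11] := PS true true.
  exists (maxn (maxn N00 N01) (maxn N10 N11)) => [|N].
    by rewrite !leq_max (ltnW k00).
  rewrite !geq_max => /andP[/andP[l00 l01] /andP[l10 l11]] /=.
  have kN : (k < N)%N by apply: leq_trans l00.
  move: (h00 _ l00) (h01 _ l01) (h10 _ l10) (h11 _ l11).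
  rewrite /Q /grid_circulation; cbv zeta.
  set h := (X in circulation X); set v := (X in circulation _ X).
  have -> : (N - k = (N - k.+1).+1)%N by lia.
  set m := (2 ^ (N - k.+1))%N; rewrite expnS -/m.
  have child (c : nat) (i : bool) : ((2 * c + i) * m = c * (2 * m) + i * m)%N.
    by rewrite mulnDl mulnA (mulnC c).
  rewrite !child !mul0n !mul1n !addn0 -!addnA !addnn -!mul2n.
  move: (_ * _)%N (b * _)%N => A B g00 g01 g10 g11.
  rewrite (@circulation_splitl _ _ _ _ (A + m)%N); last first.
    by rewrite leq_addr leq_add2l; lia.
  rewrite !(@circulation_splitr _ _ _ _ _ B (B + m) (B + 2 * m)); last 2 first.
    by rewrite leq_addr leq_add2l; lia.
    by rewrite leq_addr leq_add2l; lia.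
  have -> : e / 4 ^+ k = e / 4 ^+ k.+1 *+ 2 + e / 4 ^+ k.+1 *+ 2.
    by rewrite exprS; field; rewrite expf_neq0.
  apply: le_trans (rnormD _ _) _; apply: lerD;
  by apply: le_trans (rnormD _ _) _; rewrite mulr2n lerD.
have [D Dc GD] := Gd x y x01 y01; set c := z x y in Dc GD.
(* There are [4 * m] edges, each with error at most [L / 2 ^ N * (4 * L / 2 ^ k * e')]; as
   [2 ^ N = 2 ^ k * m], the total is [16 * L ^ 2 * e' / 4 ^ k]. The [+ 1] covers [L = 0]. *)
pose e' := e / (16 * L ^+ 2 + 1).
have L2 : 0 < 16 * L ^+ 2 + 1 by rewrite ltr_wpDl // mulr_ge0 // sqr_ge0.
have e'0 : 0 < e' by rewrite divr_gt0.
have [d d0 Dd] := Dc _ e'0.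
have [k0 k0P] : exists k0, forall k, (k0 <= k)%N -> 2 * L / 2 ^+ k < d.
  pose K := Num.truncn (d^-1 * (2 * L)); exists K.+1 => k Kk.
  rewrite ltr_pdivrMr ?exprn_gt0 // -ltr_pdivrMl //.
  apply: lt_trans (truncnS_gt _) _.
  rewrite -natrX ltr_nat; apply: leq_ltn_trans Kk _; exact: ltn_expl.
exists k0 => k a b kk ak bk xa yb; exists k => // N kN; rewrite /Q.
set m := (2 ^ (N - k))%N.
have NE : (2 : R) ^+ N = 2 ^+ k * m%:R.
  by rewrite natrX -exprD subnKC.
have [N2 k2 m0] : [/\ (0 : R) < 2 ^+ N, (0 : R) < 2 ^+ k & (0 : R) < m%:R].
  by rewrite !exprn_gt0 // ltr0n expn_gt0.
have pt (u : R) (s i : nat) : (s < 2 ^ k)%N ->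
    s%:R / 2 ^+ k <= u <= s.+1%:R / 2 ^+ k ->
    (s * m <= i <= s * m + m)%N ->
    0 <= (i%:R / 2 ^+ N : R) <= 1 /\ `|i%:R / 2 ^+ N - u| <= (2 ^+ k)^-1.
  move=> sk /andP[su us] /andP[si ism].
  have dy (t : nat) : t%:R / 2 ^+ k = (t * m)%:R / 2 ^+ N :> R.
    by rewrite NE natrM; field; rewrite !gt_eqF.
  have il : s%:R / 2 ^+ k <= (i%:R / 2 ^+ N : R).
    by rewrite dy ler_pM2r ?invr_gt0 // ler_nat.
  have ir : (i%:R / 2 ^+ N : R) <= s.+1%:R / 2 ^+ k.
    by rewrite dy ler_pM2r ?invr_gt0 // ler_nat mulSn addnC.
  have s1 : s.+1%:R / 2 ^+ k <= (1 : R) by rewrite ler_pdivrMr // mul1r -natrX ler_nat.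
  split; first by rewrite divr_ge0 ?(ltW N2) // (le_trans ir).
  have sE : s.+1%:R / 2 ^+ k = s%:R / 2 ^+ k + (2 ^+ k)^-1 :> R.
    by rewrite -natr1 mulrDl mul1r.
  by rewrite ler_norml; apply/andP; split; lra.
pose P' p q := z (p%:R / 2 ^+ N) (q%:R / 2 ^+ N).
pose near p q := [&& (a * m <= p)%N, (p <= a * m + m)%N,
  (b * m <= q)%N & (q <= b * m + m)%N].
have Pc p q : near p q -> rnorm (P' p q - c) <= 2 * L / 2 ^+ k.
  move=> /and4P[p1 p2 q1 q2].
  have [|p01 px] := pt x a p ak xa; first by rewrite p1.
  have [|q01 qy] := pt y b q bk yb; first by rewrite q1.
  apply: le_trans (zL _ _ _ _ p01 q01 x01 y01) _.
  by rewrite [2 * L]mulrC -mulrA ler_wpM2l // [leRHS]mulr_natl mulr2n lerD.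
have err p q p' q' : near p q -> near p' q' ->
    `|p'%:R - p%:R| + `|q'%:R - q%:R| = 1 :> R ->
    rnorm ((P' p' q' - P' p q) *: ((P' p q - c) *: (D (P' p q) - D c) +
      (P' p' q' - c) *: (D (P' p' q') - D c))) <=
    L / 2 ^+ N * (4 * L / 2 ^+ k * e').
  move=> npq npq' pq1; rewrite rnormZ ler_pM ?rnorm_ge0 //.
    move: npq npq' => /and4P[p1 p2 q1 q2] /and4P[p1' p2' q1' q2'].
    have [|p01 _] := pt x a p ak xa; first by rewrite p1.
    have [|q01 _] := pt y b q bk yb; first by rewrite q1.
    have [|p01' _] := pt x a p' ak xa; first by rewrite p1'.
    have [|q01' _] := pt y b q' bk yb; first by rewrite q1'.
    apply: le_trans (zL _ _ _ _ p01' q01' p01 q01) _.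
    by rewrite -!mulrBl !normrM -mulrDl pq1 mul1r ger0_norm // invr_ge0 ltW.
  have Dle u v : near u v -> rnorm ((P' u v - c) *: (D (P' u v) - D c)) <=
      2 * L / 2 ^+ k * e'.
    move=> uv; rewrite rnormZ ler_pM ?rnorm_ge0 ?Pc // ltW // Dd //.
    exact: le_lt_trans (Pc _ _ uv) (k0P _ kk).
  have -> : 4 * L / 2 ^+ k * e' = 2 * L / 2 ^+ k * e' + 2 * L / 2 ^+ k * e' by ring.
  by apply: le_trans (rnormD _ _) _; rewrite lerD ?Dle.
pose W p q := (P' p q - c) *: (G c *+ 2) + (P' p q - c) ^+ 2 *: D c.
pose er p q p' q' := (P' p' q' - P' p q) *:
  ((P' p q - c) *: (D (P' p q) - D c) + (P' p' q' - c) *: (D (P' p' q') - D c)).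
have -> : grid_circulation G z N =
    circulation (fun p q => W p.+1 q - W p q + er p q p.+1 q)
                (fun p q => W p q.+1 - W p q + er p q p q.+1).
  by congr circulation; apply: funext => p; apply: funext => q;
     apply: trapezoid_expand.
rewrite circulationD circulation_exact ?leq_addr // add0r.
have bound : 4 * m%:R * (L / 2 ^+ N * (4 * L / 2 ^+ k * e')) <= e / 4 ^+ k.
  have -> : (4 : R) ^+ k = 2 ^+ k * 2 ^+ k by rewrite -exprMn; congr (_ ^+ _); ring.
  have -> : 4 * m%:R * (L / 2 ^+ N * (4 * L / 2 ^+ k * e')) =
      (16 * L ^+ 2 * e') / (2 ^+ k * 2 ^+ k).
    by rewrite NE; field; rewrite !gt_eqF.
  rewrite ler_pM2r ?invr_gt0 ?mulr_gt0 // /e' mulrA ler_pdivrMr //.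
  by rewrite mulrDr mulr1 mulrC lerDl ltW.
apply: le_trans bound; apply: circulation_bound => p q /andP[p1 p2] /andP[q1 q2];
  apply: err; rewrite /near ?p1 ?q1 ?(ltnW p2) ?(ltnW q2) ?p2 ?q2 ?leqW //=;
  rewrite ?subrr ?normr0 ?addr0 ?add0r -natr1 addrAC subrr add0r normr1 //.
Qed.

End Goursat.

(** * Cauchy formula on circles *)

Section ComplexDifferentiable.
Context {R : realType}.
Implicit Types (E : normedModType R[i]) (V : normedZmodType R[i]).

Lemma ccont_cst V (c : V) z : ccont (fun=> c) z.
Proof. by move=> e e0; exists 1 => // w _; rewrite subrr rnorm0. Qed.

Lemma ccont_id (z : R[i]) : ccont id z.
Proof. by move=> e e0; exists e. Qed.

Lemma ccontD V (F G : R[i] -> V) z :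
  ccont F z -> ccont G z -> ccont (fun w => F w + G w) z.
Proof.
move=> Fz Gz e e0; have e2 : 0 < e / 2 by rewrite divr_gt0.
have [d d0 dF] := Fz _ e2; have [d' d'0 dG] := Gz _ e2.
exists (Num.min d d') => [|w]; first by rewrite lt_min d0.
rewrite lt_min => /andP[/dF Fw /dG Gw]; rewrite opprD addrACA.
by apply: le_lt_trans (rnormD _ _) _; lra.
Qed.

Lemma ccontZ E (k : R[i] -> R[i]) (F : R[i] -> E) z :
  ccont k z -> ccont F z -> ccont (fun w => k w *: F w) z.
Proof.
move=> kz Fz e e0.
have [K0 M0] := (rnorm_ge0 (k z), rnorm_ge0 (F z)).
pose e1 := Num.min 1 (e / (2 * (rnorm (k z) + 1))).
pose e2 := e / (2 * (rnorm (F z) + 1)).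
have e10 : 0 < e1 by rewrite lt_min ltr01 divr_gt0 // mulr_gt0 // ltr_wpDl.
have e20 : 0 < e2 by rewrite divr_gt0 // mulr_gt0 // ltr_wpDl.
have [d d0 dF] := Fz _ e10; have [d' d'0 dk] := kz _ e20.
exists (Num.min d d') => [|w]; first by rewrite lt_min d0.
rewrite lt_min => /andP[/dF + /dk kw]; rewrite lt_min => /andP[F1 Fw].
have -> : k w *: F w - k z *: F z = (k w - k z) *: F w + k z *: (F w - F z).
  by rewrite scalerBl scalerBr addrA subrK.
apply: le_lt_trans (rnormD _ _) _; rewrite !rnormZ.
have Fw1 : rnorm (F w) <= rnorm (F z) + 1.
  by apply: le_trans (rnorm_triB _ (F z)) _; rewrite lerD2l ltW.
have [F0 FD0] := (rnorm_ge0 (F w), rnorm_ge0 (F w - F z)).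
have kD0 := rnorm_ge0 (k w - k z).
have h1 : rnorm (k w - k z) * rnorm (F w) <= e / 2.
  have -> : e / 2 = e2 * (rnorm (F z) + 1).
    by rewrite /e2; field; rewrite gt_eqF // ltr_wpDl.
  by rewrite ler_pM // ltW.
have h2 : rnorm (k z) * rnorm (F w - F z) < e / 2.
  have [->|kz0] := eqVneq (rnorm (k z)) 0; first by rewrite mul0r divr_gt0.
  have kp : 0 < rnorm (k z) by rewrite lt_def kz0.
  move: Fw; rewrite -(ltr_pM2l kp) => /lt_le_trans; apply.
  rewrite mulrA ler_pdivrMr ?mulr_gt0 ?ltr_wpDl // [leRHS](_ : _ = rnorm (k z) * e + e).
    by rewrite lerDl ltW.
  by field.
lra.
Qed.

Lemma ccont_subV (a z : R[i]) : z != a -> ccont (fun w => (w - a)^-1) z.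
Proof.
move=> za e e0; set r := rnorm (z - a).
have r0 : 0 < r by rewrite rnorm_gt0 subr_eq0.
exists (Num.min (r / 2) (e * r ^+ 2 / 2)) => [|w].
  by rewrite lt_min !divr_gt0 // mulr_gt0 // exprn_gt0.
rewrite lt_min => /andP[wr we].
have wa : r / 2 < rnorm (w - a).
  have := rnorm_triB (z - a) (w - a); rewrite opprB subrKA -/r (rdistC z w).
  lra.
have wa0 : w - a != 0 by rewrite -rnorm_gt0; lra.
have za0 : z - a != 0 by rewrite subr_eq0.
have -> : (w - a)^-1 - (z - a)^-1 = (z - w) / ((w - a) * (z - a)).
  by field; rewrite za0 wa0.
rewrite rnormM rnormV rnormM rdistC ltr_pdivrMr ?mulr_gt0 ?(lt_trans _ wa) ?divr_gt0 //.
apply: lt_le_trans we _; rewrite -/r -[e * _ / 2]mulrA ler_pM2l //.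
by rewrite expr2 mulrAC ler_pM2r // ltW.
Qed.

(** Caratheodory's form asks for a slope at every [w]; away from [z] the difference quotient
    supplies it without affecting continuity at [z]. *)
Lemma cdiff_local E (K D : R[i] -> E) z (d : R) : 0 < d -> ccont D z ->
  (forall w, rnorm (w - z) < d -> K w = K z + (w - z) *: D w) -> cdiff K z.
Proof.
move=> d0 Dz KD.
pose D' w := if rnorm (w - z) < d then D w else (w - z)^-1 *: (K w - K z).
have zz : rnorm (z - z) < d by rewrite subrr rnorm0.
exists D' => [e /Dz[d' d'0 dD]|w].
  exists (Num.min d d') => [|w]; first by rewrite lt_min d0.
  by rewrite lt_min /D' => /andP[-> /dD]; rewrite zz.
rewrite /D'; case: ltP => [/KD //|wz].
have w0 : w - z != 0 by rewrite -rnorm_gt0 (lt_le_trans d0).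
by rewrite scalerA divff // scale1r subrKC.
Qed.

Lemma cdiff_cont E (H : R[i] -> E) z : cdiff H z -> ccont H z.
Proof.
move=> [D Dz HD].
rewrite (_ : H = fun w => H z + (w - z) *: D w); last by apply: funext.
apply: ccontD; first exact: ccont_cst.
apply: ccontZ => //; apply: ccontD; first exact: ccont_id.
exact: ccont_cst.
Qed.

Lemma cdiff_scaleV E (H : R[i] -> E) (a z : R[i]) : z != a -> cdiff H z ->
  cdiff (fun w => (w - a)^-1 *: H w) z.
Proof.
move=> za [D Dz HD].
have r0 : 0 < rnorm (z - a) by rewrite rnorm_gt0 subr_eq0.
apply: (@cdiff_local _ _
  (fun w => (w - a)^-1 *: (D w - (z - a)^-1 *: H z)) _ _ r0).
  apply: ccontZ; first exact: ccont_subV.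
  by apply: ccontD => //; apply: ccont_cst.
move=> w wr.
have wa0 : w - a != 0.
  by apply: contraTneq wr => /subr0_eq ->; rewrite rdistC ltxx.
have za0 : z - a != 0 by rewrite subr_eq0.
have coef : (w - a)^-1 = (z - a)^-1 - (w - z) * (w - a)^-1 * (z - a)^-1.
  by field; rewrite za0.
rewrite (HD w) scalerDr {1}coef scalerBl !scalerBr !scalerA.
by rewrite addrAC -addrA [_^-1 * (w - z)]mulrC.
Qed.

Lemma cdiffB_cst E (H : R[i] -> E) c z : cdiff H z -> cdiff (fun w => H w - c) z.
Proof. by move=> [D Dz HD]; exists D => // w; rewrite HD addrAC. Qed.

End ComplexDifferentiable.

(** * Roots of unity, circle means and the Schwarz estimate *)

Section Circle.
Context {R : realType}.
Implicit Types (E : normedModType R[i]).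

Definition circ (t : R) : R[i] := cos (2 * pi * t) +i* sin (2 * pi * t).

Lemma circ0 : circ 0 = 1.
Proof. by rewrite /circ mulr0 cos0 sin0. Qed.

Lemma circD s t : circ (s + t) = circ s * circ t.
Proof.
rewrite /circ mulrDr cosD sinD; simpc; congr (_ +i* _).
by rewrite addrC [X in X + _]mulrC.
Qed.

Lemma circ_half : circ (1 / 2) = - 1.
Proof.
by rewrite /circ mulrC mulrA mulfVK // mul1r cospi sinpi; simpc.
Qed.

Lemma circ1 : circ 1 = 1.
Proof. by rewrite [X in circ X]splitr circD circ_half mulrNN mulr1. Qed.

Lemma rnorm_circ t : rnorm (circ t) = 1.
Proof. by rewrite /rnorm normc_def /= cos2Dsin2 sqrtr1. Qed.

Lemma rnorm_complex_le (a b : R) : rnorm (a +i* b) <= `|a| + `|b|.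
Proof.
rewrite [a +i* b]complexE /= (le_trans (rnormD _ _)) // rnormM !rnormC lerD2l.
by rewrite /rnorm normc_def /= expr0n add0r expr1n sqrtr1 mul1r.
Qed.

Lemma cos_lipschitz (x y : R) : `|cos x - cos y| <= `|x - y|.
Proof.
wlog xy : x y / x <= y.
  by move=> h; have [/h//|/ltW/h] := leP x y; rewrite distrC (distrC y).
have [c _ cE] := MVT_segment xy (fun z _ => is_derive_cos z)
  (continuous_subspaceT (@continuous_cos R)).
by rewrite distrC cE normrM (distrC x) normrN ler_piMl // sin_max.
Qed.

Lemma sin_lipschitz (x y : R) : `|sin x - sin y| <= `|x - y|.
Proof.
wlog xy : x y / x <= y.
  by move=> h; have [/h//|/ltW/h] := leP x y; rewrite distrC (distrC y).
have [c _ cE] := MVT_segment xy (fun z _ => is_derive_sin z)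
  (continuous_subspaceT (@continuous_sin R)).
by rewrite distrC cE normrM (distrC x) ler_piMl // cos_max.
Qed.

Lemma circ_lipschitz s t : rnorm (circ s - circ t) <= 4 * pi * `|s - t|.
Proof.
rewrite /circ (le_trans (rnorm_complex_le _ _)) //.
have := cos_lipschitz (2 * pi * s) (2 * pi * t).
have := sin_lipschitz (2 * pi * s) (2 * pi * t).
by rewrite -mulrBr normrM ger0_norm ?mulr_ge0 ?pi_ge0 //; lra.
Qed.

Lemma rnorm_expr_sub1 (w : R[i]) m : rnorm w = 1 ->
  rnorm (w ^+ m - 1) <= m%:R * rnorm (w - 1).
Proof.
move=> w1; elim: m => [|m IH]; first by rewrite expr0 subrr rnorm0 mul0r.
have -> : w ^+ m.+1 - 1 = w * (w ^+ m - 1) + (w - 1) by rewrite exprS; ring.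
rewrite (le_trans (rnormD _ _)) // rnormM w1 mul1r -natr1 mulrDl mul1r.
by rewrite lerD2r.
Qed.

(** A primitive [2 ^ N]-th root of unity; the order is a power of two so that its powers are the
    images of the dyadic grid points. *)
Definition root2 N : R[i] := circ (1 / 2 ^+ N).

Lemma circ_nat N p : circ (p%:R / 2 ^+ N) = root2 N ^+ p.
Proof.
elim: p => [|p IH]; first by rewrite mul0r circ0.
by rewrite -natr1 mulrDl circD IH exprSr.
Qed.

Lemma root2_period N : root2 N ^+ (2 ^ N) = 1.
Proof. by rewrite -circ_nat natrX divff ?circ1 // expf_neq0. Qed.

Lemma rnorm_root2 N : rnorm (root2 N) = 1.
Proof. exact: rnorm_circ. Qed.

Lemma root2_neq0 N : root2 N != 0.
Proof. by rewrite -rnorm_gt0 rnorm_root2. Qed.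

(** The power [2 ^ (N - 2)] of [root2 N ^ 2] is [-1], at distance [2] from [1], so [root2 N ^ 2]
    itself is at distance at least [2 / 2 ^ (N - 2)]. This lower bound, uniform in [N], allows
    division by the factor of [circle_trapezoid]. *)
Lemma root2_chord N : (2 <= N)%N ->
  8 <= rnorm ((2 ^ N)%:R * (root2 N - (root2 N)^-1)).
Proof.
move=> N2; rewrite rnormM rnorm_nat.
have -> : rnorm (root2 N - (root2 N)^-1) = rnorm (root2 N ^+ 2 - 1).
  rewrite -[LHS]mul1r -(rnorm_root2 N) -rnormM mulrBr expr2 divff //.
  exact: root2_neq0.
have h : root2 N ^+ 2 ^+ (2 ^ (N - 2)) = -1.
  rewrite -exprM -expnS -circ_nat -circ_half; congr circ.
  have -> : N = (N - 2).+2 by lia.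
  by rewrite subn2 /= natrX !exprS; field; rewrite expf_neq0.
have := @rnorm_expr_sub1 (root2 N ^+ 2) (2 ^ (N - 2)).
rewrite h rnormX rnorm_root2 expr1n => /(_ erefl).
rewrite -opprD rnormN -[1 + 1]/(2%:R) rnorm_nat.
have -> : (2 ^ N = 4 * 2 ^ (N - 2))%N.
  by rewrite -[4%N]/(2 ^ 2)%N -expnD; congr expn; lia.
rewrite natrM; lra.
Qed.

(** Each trapezoid is a fixed combination of the terms [g p] and [g p.+1], and periodicity
    identifies their two sums. On a circle the trapezoidal sum is thus exactly a scalar times a mean
    of [(z - c) *: G z]. *)
Lemma circle_trapezoid E (G : R[i] -> E) (c r : R[i]) N :
  \sum_(0 <= p < 2 ^ N)
    trapezoid G (c + r * root2 N ^+ p) (c + r * root2 N ^+ p.+1) =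
  (root2 N - (root2 N)^-1) *:
    \sum_(0 <= p < 2 ^ N) (r * root2 N ^+ p) *: G (c + r * root2 N ^+ p).
Proof.
set w := root2 N; have w0 : w != 0 := root2_neq0 N.
pose g p := (r * w ^+ p) *: G (c + r * w ^+ p).
have gE p : trapezoid G (c + r * w ^+ p) (c + r * w ^+ p.+1) =
    (w - 1) *: g p + (1 - w^-1) *: g p.+1.
  rewrite /trapezoid /g scalerDr !scalerA; congr (_ *: _ + _ *: _).
    by rewrite exprS; ring.
  by rewrite exprS; field.
under eq_bigr do rewrite gE.
rewrite big_split /= -!scaler_sumr.
have -> : \sum_(0 <= p < 2 ^ N) g p.+1 = \sum_(0 <= p < 2 ^ N) g p.
  apply/eqP; rewrite -subr_eq0 -sumrB telescope_sumr //.
  by rewrite /g root2_period expr0 subrr.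
by rewrite -scalerDl; congr (_ *: _); ring.
Qed.

(** A discrete form of the integral of [F z / (z - c)] over the circle, divided by [2 i pi]. *)
Definition circle_mean E (F : R[i] -> E) (c r : R[i]) N : E :=
  (2 ^ N)%:R^-1 *: \sum_(0 <= p < 2 ^ N) F (c + r * root2 N ^+ p).

Lemma circle_mean_bound E (F : R[i] -> E) (c r : R[i]) N (K : R) :
  (forall z, rnorm (z - c) = rnorm r -> rnorm (F z) <= K) ->
  rnorm (circle_mean F c r N) <= K.
Proof.
move=> FK; rewrite /circle_mean rnormZ rnormV rnorm_nat mulrC.
rewrite ler_pdivrMr ?ltr0n ?expn_gt0 // (le_trans (rnorm_sum _ _ _)) //.
rewrite mulr_natr -[X in _ *+ X]subn0 -sumr_const_nat; apply: ler_sum => p _.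
by apply: FK; rewrite addrAC subrr add0r rnormM rnormX rnorm_root2 expr1n mulr1.
Qed.

Lemma circle_mean_cst E (a : E) (c r : R[i]) N :
  circle_mean (fun=> a) c r N = a.
Proof.
rewrite /circle_mean sumr_const_nat subn0 -(scaler_nat (2 ^ N) a) scalerA.
by rewrite mulVf ?scale1r // pnatr_eq0 expn_eq0.
Qed.

Lemma circle_meanD E (F G : R[i] -> E) (c r : R[i]) N :
  circle_mean (fun z => F z + G z) c r N = circle_mean F c r N + circle_mean G c r N.
Proof. by rewrite /circle_mean big_split scalerDr. Qed.

Lemma circle_meanZ E (F : R[i] -> E) (a c r : R[i]) N :
  circle_mean (fun z => a *: F z) c r N = a *: circle_mean F c r N.
Proof. by rewrite /circle_mean -scaler_sumr !scalerA mulrC. Qed.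

Lemma eq_circle_mean E (F G : R[i] -> E) (c r : R[i]) N :
  (forall z, rnorm (z - c) = rnorm r -> F z = G z) ->
  circle_mean F c r N = circle_mean G c r N.
Proof.
move=> FG; congr (_ *: _); apply: eq_bigr => p _; apply: FG.
by rewrite addrAC subrr add0r rnormM rnormX rnorm_root2 expr1n mulr1.
Qed.

(* The circles of radius [(1 - t) rho + t eta] about [t z0] sweep out the region
   between [|z| = rho] and the circle of radius [eta] about [z0], avoiding [z0]. *)
Lemma cauchy_formula E (H : R[i] -> E) (z0 : R[i]) (rho : R) :
  rnorm z0 < rho -> ccont H z0 ->
  (forall z, rnorm z <= rho -> z != z0 -> cdiff H z) ->
  forall e : R, 0 < e -> exists N0, forall N, (N0 <= N)%N ->
    rnorm (circle_mean (fun z => (z / (z - z0)) *: H z) 0 rho%:C N - H z0) <= e.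
Proof.
move=> z0r Hz0 Hd e e0; have r0 : 0 < rho := le_lt_trans (rnorm_ge0 _) z0r.
have e2 : 0 < e / 2 by rewrite divr_gt0.
have [d d0 dH] := Hz0 _ e2.
(* The first bound brings [H] within [e / 2] of [H z0] on the inner circle; the second keeps all
   intermediate circles in the closed disc of radius [rho]. *)
pose eta := Num.min (d / 2) (rho - rnorm z0).
have eta0 : 0 < eta by rewrite lt_min divr_gt0 //= subr_gt0.
have etad : eta < d by rewrite gt_min ltr_pdivrMr // mulr_natr mulr2n ltrDl d0.
have etar : eta <= rho - rnorm z0 by rewrite ge_min lexx orbT.
pose rad t := (1 - t) * rho + t * eta.
pose z x t := t%:C * z0 + (rad t)%:C * circ x.
pose L := rnorm z0 + rho + rho * (4 * pi).
pose G w := (w - z0)^-1 *: H w.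
have radC t : (rad t)%:C = (1 - t%:C) * rho%:C + t%:C * eta%:C.
  by rewrite /rad rmorphD /= !rmorphM /= rmorphB /= rmorph1.
have rad0 t : 0 <= t <= 1 -> 0 < rad t <= rho.
  move=> /andP[t0 t1]; rewrite /rad; have er : eta <= rho.
    by rewrite (le_trans etar) // gerBl rnorm_ge0.
  apply/andP; split; nra.
have zG x t : 0 <= x <= 1 -> 0 <= t <= 1 -> cdiff G (z x t).
  move=> _ t01; have /andP[rt0 rt1] := rad0 _ t01; have /andP[t0 t1] := t01.
  have zz0 : z x t != z0.
    rewrite -subr_eq0 -rnorm_gt0.
    have -> : z x t - z0 = (rad t)%:C * circ x - (1 - t)%:C * z0.
      by rewrite /z rmorphB rmorph1; ring.
    have := rnorm_triB ((rad t)%:C * circ x) ((1 - t)%:C * z0).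
    rewrite !rnormM rnorm_circ mulr1 !rnormC (ger0_norm (ltW rt0)).
    rewrite (@ger0_norm _ (1 - t)) ?subr_ge0 // /rad => h.
    have n0 := rnorm_ge0 z0; nra.
  apply: cdiff_scaleV => //; apply: Hd => //.
  rewrite /z (le_trans (rnormD _ _)) // !rnormM rnorm_circ mulr1 !rnormC.
  rewrite (ger0_norm t0) (ger0_norm (ltW rt0)) /rad.
  have n0 := rnorm_ge0 z0; nra.
have L0 : 0 <= L by rewrite !addr_ge0 ?rnorm_ge0 ?mulr_ge0 ?pi_ge0 // ltW.
have zL x t x' t' : 0 <= x <= 1 -> 0 <= t <= 1 -> 0 <= x' <= 1 -> 0 <= t' <= 1 ->
    rnorm (z x t - z x' t') <= L * (`|x - x'| + `|t - t'|).
  move=> _ _ _ /rad0 /andP[rt0 rt1].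
  have -> : z x t - z x' t' = (t - t')%:C * z0 +
      ((t - t') * (eta - rho))%:C * circ x + (rad t')%:C * (circ x - circ x').
    rewrite /z !radC rmorphM /= !rmorphB /=; ring.
  apply: le_trans (rnormD _ _) _; rewrite rnormM rnormC (ger0_norm (ltW rt0)).
  have h1 : rnorm ((t - t')%:C * z0 + ((t - t') * (eta - rho))%:C * circ x)
      <= `|t - t'| * (rnorm z0 + rho).
    apply: le_trans (rnormD _ _) _.
    rewrite !rnormM !rnormC rnorm_circ mulr1 normrM -mulrDr ler_wpM2l // lerD2l.
    rewrite ler_norml; have n0 := rnorm_ge0 z0; apply/andP; split; lra.
  have h2 : rad t' * rnorm (circ x - circ x') <= rho * (4 * pi * `|x - x'|).
    by rewrite ler_pM ?rnorm_ge0 ?circ_lipschitz // ltW.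
  apply: le_trans (lerD h1 h2) _; rewrite /L.
  have n1 := normr_ge0 (t - t'); have n2 := normr_ge0 (x - x').
  have n3 := rnorm_ge0 z0; have n4 := @pi_ge0 R.
  have : 0 <= `|x - x'| * (rnorm z0 + rho) by rewrite mulr_ge0 // addr_ge0 // ltW.
  have : 0 <= `|t - t'| * (rho * (4 * pi)) by rewrite !mulr_ge0 // ltW.
  lra.
(* The tolerance [4 * e] becomes [e / 2] for the difference of the two means once divided by the
   factor [8] of [root2_chord]. *)
have [N0 N0P] := goursat_grid L0 zL zG (mulr_gt0 (ltr0n R 4) e0).
exists (maxn N0 2) => N; rewrite geq_max => /andP[/N0P + N2].
have nn : (2 ^ N)%:R / 2 ^+ N = 1 :> R by rewrite natrX divff // expf_neq0.
rewrite /grid_circulation /circulation mul0r nn.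
(* The two sides [x = 0] and [x = 1] have the same image, so their contributions cancel; the other
   two are the outer and the inner circle. *)
under [X in _ + X]eq_bigr do rewrite !/(z _ _) circ0 circ1 subrr.
rewrite big1_eq addr0 sumrB.
have z_0 p : z (p%:R / 2 ^+ N) 0 = 0 + rho%:C * root2 N ^+ p.
  by rewrite /z /rad mul0r subr0 mul1r mul0r addr0 circ_nat.
have z_1 p : z (p%:R / 2 ^+ N) 1 = z0 + eta%:C * root2 N ^+ p.
  by rewrite /z /rad mul1r subrr mul0r mul1r add0r circ_nat.
under eq_bigr do rewrite !z_0.
under [X in _ - X]eq_bigr do rewrite !z_1.
rewrite !circle_trapezoid -scalerBr.
have n0 : (2 ^ N)%:R != 0 :> R[i] by rewrite pnatr_eq0 expn_eq0.
pose F w := (w / (w - z0)) *: H w; pose M1 := circle_mean F 0 rho%:C N.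
pose M2 := circle_mean H z0 eta%:C N.
have -> : \sum_(0 <= p < 2 ^ N) (rho%:C * root2 N ^+ p) *:
    G (0 + rho%:C * root2 N ^+ p) = (2 ^ N)%:R *: M1.
  rewrite /M1 /circle_mean scalerA divff // scale1r; apply: eq_bigr => p _.
  by rewrite /G /F scalerA add0r.
have -> : \sum_(0 <= p < 2 ^ N) (eta%:C * root2 N ^+ p) *:
    G (z0 + eta%:C * root2 N ^+ p) = (2 ^ N)%:R *: M2.
  rewrite /M2 /circle_mean scalerA divff // scale1r; apply: eq_bigr => p _.
  rewrite /G addrAC subrr add0r scalerA divff ?scale1r //.
  rewrite mulf_neq0 ?expf_neq0 ?root2_neq0 //.
  by rewrite -rnorm_gt0 rnormC normr_gt0 gt_eqF.
rewrite -scalerBr scalerA rnormZ [_ * _%:R]mulrC => M12.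
have chord := root2_chord N2.
have M12e : rnorm (M1 - M2) <= e / 2.
  have := rnorm_ge0 (M1 - M2); nra.
have M2e : rnorm (M2 - H z0) <= e / 2.
  have -> : M2 - H z0 = circle_mean (fun w => H w + - H z0) z0 eta%:C N.
    by rewrite circle_meanD circle_mean_cst.
  apply: circle_mean_bound => w; rewrite rnormC (ger0_norm (ltW eta0)) => wE.
  by rewrite ltW // dH // wE.
rewrite -/F -/M1 -(subrKA M2) (le_trans (rnormD _ _)) // (splitr e) lerD //.
Qed.

Lemma cdiff_scaleXV E (H : R[i] -> E) (z : R[i]) k : z != 0 -> cdiff H z ->
  cdiff (fun w => (w ^+ k)^-1 *: H w) z.
Proof.
move=> z0 Hz; elim: k => [|k IH].
  rewrite (_ : (fun _ => _) = H) //; apply: funext => w.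
  by rewrite expr0 invr1 scale1r.
rewrite (_ : (fun _ => _) = fun w => (w - 0)^-1 *: ((w ^+ k)^-1 *: H w)).
  exact: cdiff_scaleV.
by apply: funext => w; rewrite subr0 scalerA -invfM exprS.
Qed.

(* Each term [(z0 / z) ^ k], [k <= m], of the expansion of [z / (z - z0)] in
   powers of [z0 / z] has vanishing mean against [H]; only the remainder
   [(z0 / z) ^ m.+1 * (z / (z - z0))] is left to estimate. *)
Lemma schwarz_bound E (H : R[i] -> E) (z0 : R[i]) (rho K : R) m :
  rnorm z0 < rho ->
  (forall z, rnorm z <= rho -> cdiff H z) ->
  (forall e : R, 0 < e -> exists2 d : R, 0 < d & forall z, rnorm z < d ->
     rnorm (H z) <= e * rnorm z ^+ m) ->
  (forall z, rnorm z = rho -> rnorm (H z) <= K) ->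
  rnorm (H z0) <= K * (rnorm z0 / rho) ^+ m.+1 * (rho / (rho - rnorm z0)).
Proof.
move=> z0r Hd Ho HK; have r0 : 0 < rho := le_lt_trans (rnorm_ge0 _) z0r.
have [K0|K0] := ltP K 0.
  have rr : rnorm rho%:C = rho by rewrite rnormC (ger0_norm (ltW r0)).
  by have := le_lt_trans (le_trans (rnorm_ge0 _) (HK _ rr)) K0; rewrite ltxx.
have H00 : H 0 = 0.
  apply/eqP; rewrite -rnorm_eq0 eq_le rnorm_ge0 andbT.
  apply/ler_addgt0Pr => e e0; rewrite add0r.
  have [d d0 /(_ 0)] := Ho e e0; rewrite rnorm0 => /(_ d0) /le_trans; apply.
  by rewrite expr0n; case: (m == 0)%N; rewrite ?mulr1 ?mulr0 // ltW.
(* Cauchy's formula at [0] for [H z / z ^ k], given the value [0] there: since [k <= m], the decay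
   of [H] makes this value continuous. *)
have mean0 k : (k <= m)%N -> forall e : R, 0 < e -> exists N0, forall N,
    (N0 <= N)%N -> rnorm (circle_mean (fun z => (z ^+ k)^-1 *: H z) 0 rho%:C N) <= e.
  move=> km e e0; pose Hk z := (z ^+ k)^-1 *: H z.
  have Hk0 : Hk 0 = 0 by rewrite /Hk H00 scaler0.
  have Hkc : ccont Hk 0.
    move=> e' e'0; have [d d0 dH] := Ho (e' / 2) (divr_gt0 e'0 (ltr0n R 2)).
    exists (Num.min d 1) => [|w]; first by rewrite lt_min d0 ltr01.
    rewrite subr0 Hk0 subr0 lt_min => /andP[/dH wd w1].
    have [->|w0] := eqVneq w 0; first by rewrite Hk0 rnorm0.
    have wp : 0 < rnorm w by rewrite rnorm_gt0.
    rewrite /Hk rnormZ rnormV rnormX mulrC ltr_pdivrMr ?exprn_gt0 //.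
    apply: le_lt_trans wd _; rewrite -(subnK km) exprD mulrA.
    rewrite ltr_pM2r ?exprn_gt0 //.
    have : rnorm w ^+ (m - k) <= 1 by rewrite exprn_ile1 // ltW.
    nra.
  have Hkd z : rnorm z <= rho -> z != 0 -> cdiff Hk z.
    by move=> zr zn0; apply: cdiff_scaleXV => //; apply: Hd.
  have rn0 : rnorm (0 : R[i]) < rho by rewrite rnorm0.
  have [N0 N0P] := cauchy_formula rn0 Hkc Hkd e0.
  exists N0 => N /N0P; rewrite Hk0 subr0; congr (rnorm _ <= _).
  apply: eq_circle_mean => z; rewrite subr0 rnormC (ger0_norm (ltW r0)) => zr.
  by rewrite divff ?scale1r // -rnorm_gt0 zr.
pose Q j z := (z0 / z) ^+ j * (z / (z - z0)).
have tail j : (j <= m.+1)%N -> forall e : R, 0 < e -> exists N0, forall N,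
    (N0 <= N)%N ->
    rnorm (circle_mean (fun z => Q j z *: H z) 0 rho%:C N - H z0) <= e.
  elim: j => [_ e e0|j IH jm e e0].
    have Hz0 : ccont H z0 := cdiff_cont (Hd _ (ltW z0r)).
    have [N0 N0P] := cauchy_formula z0r Hz0 (fun z zr _ => Hd z zr) e0.
    exists N0 => N /N0P; congr (rnorm (_ - _) <= _).
    by apply: eq_circle_mean => z _; rewrite /Q expr0 mul1r.
  pose c := rnorm (z0 ^+ j) + 1; have c0 : 0 < c by rewrite ltr_wpDl ?rnorm_ge0.
  have [N1 N1P] := IH (ltnW jm) _ (divr_gt0 e0 (ltr0n R 2)).
  have [N2 N2P] := mean0 j jm (e / (2 * c)) (divr_gt0 e0 (mulr_gt0 (ltr0n R 2) c0)).
  exists (maxn N1 N2) => N; rewrite geq_max => /andP[/N1P h1 /N2P h2].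
  have QS z : rnorm (z - 0) = rnorm rho%:C -> Q j.+1 z *: H z =
      Q j z *: H z + (- z0 ^+ j) *: ((z ^+ j)^-1 *: H z).
    rewrite subr0 rnormC (ger0_norm (ltW r0)) => zr; rewrite scalerA -scalerDl.
    have zn0 : z != 0 by rewrite -rnorm_gt0 zr.
    have zz0 : z - z0 != 0.
      by apply: contraTneq z0r => /subr0_eq <-; rewrite zr ltxx.
    congr (_ *: _); rewrite /Q !expr_div_n exprS exprS; field.
    by rewrite zz0 zn0 expf_neq0.
  rewrite (eq_circle_mean _ QS) circle_meanD circle_meanZ addrAC.
  apply: le_trans (rnormD _ _) _; rewrite rnormZ rnormN.
  have h3 : rnorm (z0 ^+ j) * (e / (2 * c)) <= e / 2.
    have -> : e / 2 = c * (e / (2 * c)) by field; rewrite gt_eqF.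
    by rewrite ler_wpM2r ?lerDl // divr_ge0 ?mulr_ge0 // ltW.
  have := ler_wpM2l (rnorm_ge0 (z0 ^+ j)) h2; lra.
apply/ler_addgt0Pr => e e0.
have [N0 /(_ _ (leqnn N0)) h] := tail _ (leqnn _) _ e0.
apply: le_trans (rnorm_triB _ _) _; rewrite rdistC in h; apply: lerD h.
apply: circle_mean_bound => z; rewrite subr0 rnormC (ger0_norm (ltW r0)) => zr.
have zz0 : rho - rnorm z0 <= rnorm (z - z0).
  by rewrite lerBlDl -zr rnorm_triB.
have rz0 : 0 < rho - rnorm z0 by rewrite subr_gt0.
rewrite rnormZ mulrC -mulrA ler_pM ?rnorm_ge0 ?HK //.
rewrite /Q rnormM rnormX !rnormM !rnormV zr ler_wpM2l //.
  by rewrite exprn_ge0 // divr_ge0 ?rnorm_ge0 // ltW.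
by rewrite ler_wpM2l ?lef_pV2 ?posrE ?(ltW r0) // (lt_le_trans rz0).
Qed.

End Circle.

(** * Schwarz and Cartan lemmas in Banach spaces *)

Section Differentials.
Context {R : realType}.
Implicit Types E F : completeNormedModType R[i].

Lemma unit_ballE E (x : E) : unit_ball E x = (rnorm x < 1).
Proof. by rewrite /unit_ball /= -(rnorm_lt x 1). Qed.

Lemma nbhs_rnormP E (P : set E) (x : E) :
  nbhs x P <-> exists2 d : R, 0 < d & forall y, rnorm (y - x) < d -> P y.
Proof.
split => [/nbhs_normP[d d0 dP]|[d d0 dP]].
  have dE : d = (complex.Re d)%:C by rewrite RRe_real // gtr0_real.
  exists (complex.Re d) => [|y yd]; first by rewrite -ltcR -dE.
  by apply: dP; rewrite /= distrC dE rnorm_lt.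
apply/nbhs_normP; exists d%:C; first by rewrite /= ltcR.
by move=> y /=; rewrite distrC rnorm_lt => /dP.
Qed.

Lemma continuous_rnorm E F (f : E -> F) (x : E) : {for x, continuous f} ->
  forall e : R, 0 < e -> exists2 d : R, 0 < d &
    forall y, rnorm (y - x) < d -> rnorm (f y - f x) < e.
Proof.
move=> fx e e0; apply/nbhs_rnormP.
have : nbhs (f x) [set y | rnorm (y - f x) < e].
  by apply/nbhs_rnormP; exists e.
exact: fx.
Qed.

Lemma differentiable_rnorm E F (f : E -> F) (x : E) : differentiable f x ->
  forall e : R, 0 < e -> exists2 d : R, 0 < d &
    forall y, rnorm (y - x) < d ->
      rnorm (f y - f x - 'd f x (y - x)) <= e * rnorm (y - x).
Proof.
move=> fd e e0; have := diff_locally fd => /eqaddoP /(_ e%:C).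
rewrite ltcR => /(_ e0) /nbhs_rnormP[d d0 dP].
exists d => // y yd; have := dP (y - x); rewrite subr0 => /(_ yd).
rewrite /= !fctE /= subrK !normE -rmorphM lecR.
by rewrite opprD addrA.
Qed.

Lemma cdiff_line E F (f : E -> F) (x v : E) (z : R[i]) :
  differentiable f (x + z *: v) -> cdiff (fun w => f (x + w *: v)) z.
Proof.
set p := x + z *: v => fp; set H := fun w => _.
pose D w := if w == z then 'd f p v else (w - z)^-1 *: (H w - H z).
exists D => [e e0|w]; last first.
  rewrite /D; case: eqVneq => [->|wz]; first by rewrite subrr scale0r addr0.
  by rewrite scalerA divff ?subr_eq0 // scale1r subrKC.
pose c := 2 * (rnorm v + 1); have c0 : 0 < c.
  by rewrite mulr_gt0 // ltr_wpDl ?rnorm_ge0.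
have [d d0 dP] := differentiable_rnorm fp (divr_gt0 e0 c0).
exists (d / (rnorm v + 1)) => [|w]; first by rewrite divr_gt0 // ltr_wpDl ?rnorm_ge0.
rewrite ltr_pdivlMr ?ltr_wpDl ?rnorm_ge0 // => wd.
rewrite /D eqxx; case: eqVneq => [_|wz]; first by rewrite subrr rnorm0.
have wz0 : 0 < rnorm (w - z) by rewrite rnorm_gt0 subr_eq0.
have wzE : x + w *: v - p = (w - z) *: v.
  by rewrite /p opprD addrACA subrr add0r -scalerBl.
have := dP (x + w *: v); rewrite wzE rnormZ linearZ /= => h.
have {}h : rnorm (H w - H z - (w - z) *: 'd f p v) <= e / c * (rnorm (w - z) * rnorm v).
  by apply: h; apply: le_lt_trans wd; rewrite ler_wpM2l ?rnorm_ge0 // lerDl.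
have -> : (w - z)^-1 *: (H w - H z) - 'd f p v =
    (w - z)^-1 *: (H w - H z - (w - z) *: 'd f p v).
  by rewrite [RHS]scalerBr scalerA mulVf ?scale1r // subr_eq0.
rewrite rnormZ rnormV mulrC ltr_pdivrMr //.
apply: le_lt_trans h _; rewrite mulrCA mulrC ltr_pM2r // mulrAC ltr_pdivrMr //.
rewrite ltr_pM2l // /c; have := rnorm_ge0 v; lra.
Qed.

(** [u x = o(|x| ^ m)] at [0], in place of the vanishing of the Taylor terms of degree at most
    [m]. *)
Definition small_order E F (u : E -> F) m := forall e : R, 0 < e ->
  exists2 d : R, 0 < d & forall x, rnorm x < d -> rnorm (u x) <= e * rnorm x ^+ m.

Lemma ball_schwarz E F (u : E -> F) (K rho : R) m (x : E) :
  holomorphic (unit_ball E) u ->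
  (forall x, unit_ball E x -> rnorm (u x) <= K) -> small_order u m ->
  rnorm x < rho < 1 ->
  rnorm (u x) <= K * (rnorm x / rho) ^+ m.+1 * (rho / (rho - rnorm x)).
Proof.
move=> ud uK uo /andP[xr r1]; set t := rnorm x; pose v := (t^-1)%:C *: x.
have t0 : 0 <= t := rnorm_ge0 x.
have xE : x = t%:C *: v.
  rewrite /v scalerA -rmorphM /=; have [t00|tn] := eqVneq t 0.
    by rewrite t00 mul0r scale0r; apply/eqP; rewrite -rnorm_eq0 -/t t00.
  by rewrite divff // scale1r.
have v1 : rnorm v <= 1.
  rewrite /v rnormZ rnormC ger0_norm ?invr_ge0 // -/t.
  by have [->|tn] := eqVneq t 0; rewrite ?mulr0 // mulVf.
have tE : rnorm t%:C = t by rewrite rnormC ger0_norm.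
have vle z : rnorm (z *: v) <= rnorm z.
  by rewrite rnormZ ler_piMr ?rnorm_ge0.
have := @schwarz_bound _ _ (fun z => u (z *: v)) t%:C rho K m.
rewrite tE -xE; apply => //.
- move=> z zr.
  suff : cdiff (fun w => u (0 + w *: v)) z.
    by congr (cdiff _ _); apply: funext => w; rewrite add0r.
  apply: cdiff_line; apply: ud; rewrite add0r unit_ballE.
  exact: le_lt_trans (vle z) (le_lt_trans zr r1).
- move=> e e0; have [d d0 dP] := uo e e0; exists d => // z zd.
  rewrite (le_trans (dP _ (le_lt_trans (vle z) zd))) // ler_wpM2l ?(ltW e0) //.
  by rewrite lerXn2r ?nnegrE ?rnorm_ge0.
- move=> z zr; apply: uK; rewrite unit_ballE.
  by rewrite (le_lt_trans (vle z)) // zr.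
Qed.

(** With [rho = 3 / 4] and [|x| <= 1 / 2], the last factor of [ball_schwarz] is at most [3] and
    [|x| / rho <= 2 * |x|]. *)
Lemma half_ball_schwarz E F (u : E -> F) (K : R) m (x : E) :
  holomorphic (unit_ball E) u ->
  (forall x, unit_ball E x -> rnorm (u x) <= K) -> small_order u m ->
  rnorm x <= 1 / 2 -> rnorm (u x) <= 3 * 2 ^+ m.+1 * K * rnorm x ^+ m.+1.
Proof.
move=> ud uK uo x2.
have K0 : 0 <= K.
  apply: le_trans (uK 0 _); first exact: rnorm_ge0.
  by rewrite unit_ballE rnorm0.
have xr : rnorm x < (3 / 4 : R) < 1 by apply/andP; split; lra.
apply: le_trans (ball_schwarz ud uK uo xr) _.
have -> : 3 * 2 ^+ m.+1 * K * rnorm x ^+ m.+1 = K * ((2 * rnorm x) ^+ m.+1 * 3).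
  by rewrite exprMn; ring.
have t0 := rnorm_ge0 x; rewrite -mulrA ler_wpM2l //.
apply: ler_pM.
- by rewrite exprn_ge0 // divr_ge0.
- by rewrite divr_ge0 // subr_ge0; lra.
- rewrite lerXn2r ?nnegrE ?mulr_ge0 ?divr_ge0 //; lra.
- by rewrite ler_pdivrMr; lra.
Qed.

(** For fixed [rho] between [|x|] and [1], only the factor [(|x| / rho) ^ (m + 2)] of the Schwarz
    bound depends on [m], and it tends to [0]. *)
Lemma ball_identity E F (u : E -> F) (K : R) (x : E) :
  holomorphic (unit_ball E) u ->
  (forall x, unit_ball E x -> rnorm (u x) <= K) ->
  (forall m, small_order u m.+1) -> unit_ball E x -> u x = 0.
Proof.
move=> ud uK uo; rewrite unit_ballE => x1.
pose rho := (rnorm x + 1) / 2.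
have xr : rnorm x < rho < 1 by rewrite /rho; apply/andP; split; lra.
have /andP[xr1 _] := xr; have t0 := rnorm_ge0 x.
set q := rnorm x / rho.
have q0 : 0 <= q by rewrite divr_ge0 //; lra.
have q1 : q < 1 by rewrite ltr_pdivrMr; lra.
pose B := K * (rho / (rho - rnorm x)).
have bnd m : rnorm (u x) <= B * q ^+ m.+2.
  by rewrite /B mulrAC; exact: (ball_schwarz ud uK (uo m) xr).
have K0 : 0 <= K.
  apply: le_trans (uK 0 _); first exact: rnorm_ge0.
  by rewrite unit_ballE rnorm0.
have B0 : 0 <= B by rewrite mulr_ge0 // divr_ge0 ?subr_ge0 //; lra.
apply/eqP; rewrite -rnorm_eq0 eq_le rnorm_ge0 andbT.
apply/ler_addgt0Pr => e e0; rewrite add0r.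
have /cvg_expr /cvgrPdist_le : `|q| < 1 by rewrite ger0_norm.
have B1 : 0 < B + 1 by lra.
move=> /(_ _ (divr_gt0 e0 B1)) [N _ /(_ N.+2 (leqW (leqW (leqnn N))))] /=.
rewrite sub0r normrN ger0_norm ?exprn_ge0 // ler_pdivlMr // => qe.
have := bnd N; have := exprn_ge0 N.+2 q0; lra.
Qed.

(** Schwarz's estimate of order [0] for [z |-> u (x + z *: w) - u x] on the disc of radius
    [rho = r / |w|], taken at [z = 1]; the bound [2 * M / (rho - 1)] is at most [4 * M / rho]
    because [rho >= 2]. *)
Lemma local_lipschitz E F (u : E -> F) (M r : R) (x w : E) :
  holomorphic (unit_ball E) u -> 0 < r -> 2 * r < 1 ->
  (forall y, rnorm y <= 2 * r -> rnorm (u y) <= M) ->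
  rnorm x <= r -> rnorm w <= r / 2 ->
  rnorm (u (x + w) - u x) <= 4 * M * rnorm w / r.
Proof.
move=> ud r0 r1 uM xr wr.
have M0 : 0 <= M.
  apply: le_trans (uM 0 _); first exact: rnorm_ge0.
  by rewrite rnorm0; lra.
have [->|w0] := eqVneq w 0.
  by rewrite addr0 subrr !rnorm0 mulr0 mul0r.
have wp : 0 < rnorm w by rewrite rnorm_gt0.
pose rho := r / rnorm w; have rho2 : 2 <= rho.
  by rewrite ler_pdivlMr //; lra.
have inside z : rnorm z <= rho -> rnorm (x + z *: w) <= 2 * r.
  rewrite ler_pdivlMr // => zr.
  by apply: le_trans (rnormD _ _) _; rewrite rnormZ; lra.
pose H z := u (x + z *: w) - u x.
have Hd z : rnorm z <= rho -> cdiff H z.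
  move=> /inside zr; apply: cdiffB_cst; apply: cdiff_line; apply: ud.
  by rewrite unit_ballE; lra.
have H0 : H 0 = 0 by rewrite /H scale0r addr0 subrr.
have rho0 : 0 < rho by lra.
have n1 : rnorm (1 : R[i]) < rho by rewrite rnorm1; lra.
have Ho e : 0 < e -> exists2 d : R, 0 < d & forall z, rnorm z < d ->
    rnorm (H z) <= e * rnorm z ^+ 0.
  have : rnorm (0 : R[i]) <= rho by rewrite rnorm0 ltW.
  move=> /Hd/cdiff_cont Hc /Hc [d d0 dP]; exists d => // z zd.
  by have := dP z; rewrite subr0 H0 subr0 expr0 mulr1 => /(_ zd)/ltW.
have HM z : rnorm z = rho -> rnorm (H z) <= 2 * M.
  move=> zr; apply: le_trans (rnormB _ _) _.
  have h1 : rnorm (u (x + z *: w)) <= M by apply/uM/inside; rewrite zr.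
  have h2 : rnorm (u x) <= M by apply: uM; lra.
  lra.
have := schwarz_bound n1 Hd Ho HM; rewrite /H scale1r rnorm1 => /le_trans; apply.
have rho1 : 0 < rho - 1 by lra.
have -> : 2 * M * (1 / rho) ^+ 1 * (rho / (rho - 1)) = 2 * M / (rho - 1).
  by field; rewrite !gt_eqF.
have -> : 4 * M * rnorm w / r = 4 * M / rho.
  by rewrite /rho; field; rewrite !gt_eqF.
by rewrite ler_pdivrMr // mulrAC ler_pdivlMr //; nra.
Qed.

End Differentials.

(** * Cartan's uniqueness theorem by iteration *)

Section Cartan.
Context {R : realType} {E : completeNormedModType R[i]}.
Variable h : E -> E.
Hypothesis h_holo : holomorphic (unit_ball E) h.
Hypothesis h_ball : forall x, unit_ball E x -> unit_ball E (h x).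
Hypothesis h_0 : h 0 = 0.

Let u x := h x - x.

Lemma iter_ball k x : unit_ball E x -> unit_ball E (iter k h x).
Proof. by move=> x1; elim: k => //= k /h_ball. Qed.

Lemma iter_holomorphic k : holomorphic (unit_ball E) (iter k h).
Proof.
move=> x x1; elim: k => [|k IH] /=; first exact: ex_diff.
apply: (@differentiable_comp _ _ _ _ (iter k h) h) => //.
exact/h_holo/iter_ball.
Qed.

Lemma iter_sub_holomorphic k :
  holomorphic (unit_ball E) (fun x => iter k h x - x).
Proof.
move=> x x1; apply: (@differentiableB _ _ _ (iter k h) id).
  exact: iter_holomorphic.
exact: ex_diff.
Qed.

Lemma iter_sub_bound k x : unit_ball E x -> rnorm (iter k h x - x) <= 2.
Proof.
move=> x1; have := iter_ball k x1; move: x1; rewrite !unit_ballE => x1 y1.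
by apply: le_trans (rnormB _ _) _; lra.
Qed.

(* To order [m + 2], the [k]-th iterate moves points [k] times as far as [h]. *)
Lemma iter_expansion (C : R) m k : 0 <= C ->
  (forall x, rnorm x <= 1 / 2 -> rnorm (u x) <= C * rnorm x ^+ m.+2) ->
  exists B d : R, [/\ 0 <= B, 0 < d & forall x, rnorm x < d ->
    rnorm (iter k h x - x - k%:R *: u x) <= B * rnorm x ^+ m.+3].
Proof.
move=> C0 uC; elim: k => [|k [B [d [B0 d0 IH]]]].
  by exists 0, 1; split => // x _; rewrite subrr scale0r subrr rnorm0 mul0r.
pose A := k%:R * C + B; have A0 : 0 <= A by rewrite addr_ge0 // mulr_ge0.
(* The new term bounds [u (x + w) - u x] by [local_lipschitz] with [r = |x|], where the displacement
   [w] is at most [A * |x| ^ (m + 2)]. The radius [1 / 4] keeps the ball of radius [2 * |x|] where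
   the bound on [u] holds, and [A * |x| <= 1 / 2] gives [|w| <= |x| / 2]. *)
pose B' := B + 4 * (C * 2 ^+ m.+2) * A.
pose d' := Num.min d (Num.min (1 / 4) (1 / (2 * (A + 1)))).
have d'0 : 0 < d'.
  rewrite /d' !lt_min d0 /= divr_gt0 //= divr_gt0 // mulr_gt0 //; lra.
exists B', d'; split => //.
  by rewrite /B' addr_ge0 // mulr_ge0 // mulr_ge0 // mulr_ge0 // exprn_ge0.
move=> x; rewrite !lt_min => /and3P[xd x4 xA].
have t0 := rnorm_ge0 x; set t := rnorm x in t0 xd x4 xA *.
set w := iter k h x - x; set v := w - k%:R *: u x.
have -> : iter k.+1 h x - x - k.+1%:R *: u x = v + (u (x + w) - u x).
  rewrite /v /w subrKC iterS; set y := iter k h x.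
  have -> : u y = h y - y by [].
  rewrite -natr1 scalerDl scale1r opprD [LHS]addrA [RHS]addrA; congr (_ - _).
  by rewrite [RHS]addrAC; congr (_ - _); rewrite [RHS]addrC subrKA.
have vB : rnorm v <= B * t ^+ m.+3 by apply: IH.
have uB : rnorm (u x) <= C * t ^+ m.+2 by apply: uC; lra.
have tm : 0 <= t ^+ m.+2 by rewrite exprn_ge0.
have tS : t ^+ m.+3 <= t ^+ m.+2.
  by rewrite exprS ler_piMl //; lra.
have wA : rnorm w <= A * t ^+ m.+2.
  rewrite -(subrK (k%:R *: u x) w) -/v.
  apply: le_trans (rnormD _ _) _; rewrite rnormZ rnorm_nat.
  have := ler_wpM2l (ler0n R k) uB; have := ler_wpM2l B0 tS; rewrite /A; lra.
apply: le_trans (rnormD _ _) _; rewrite /B' mulrDl lerD //.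
have [t00|tn] := eqVneq t 0.
  have x0 : x = 0 by apply/eqP; rewrite -rnorm_eq0 -/t t00.
  have w0 : w = 0.
    apply/eqP; rewrite -rnorm_eq0 eq_le rnorm_ge0 andbT.
    by apply: le_trans wA _; rewrite t00 expr0n mulr0.
  by rewrite x0 w0 addr0 subrr rnorm0 mulr_ge0 ?exprn_ge0 //
    mulr_ge0 // mulr_ge0 // mulr_ge0 // exprn_ge0.
have tp : 0 < t by rewrite lt_def tn.
have wt : rnorm w <= t / 2.
  apply: le_trans wA _.
  have tm1 : t ^+ m.+2 <= t * t.
    by rewrite !exprS mulrA ler_piMr ?mulr_ge0 // exprn_ile1 //; lra.
  have AT : A * t <= 1 / 2.
    move: xA; rewrite ltr_pdivlMr ?mulr_gt0 //; [nra|lra].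
  have := ler_wpM2l A0 tm1; nra.
have uM y : rnorm y <= 2 * t -> rnorm (u y) <= C * (2 * t) ^+ m.+2.
  move=> yt; apply: le_trans (uC y _) _; first by lra.
  by rewrite ler_wpM2l // lerXn2r ?nnegrE ?rnorm_ge0 // mulr_ge0.
have t2 : 2 * t < 1 by lra.
have := local_lipschitz (iter_sub_holomorphic 1) tp t2 uM (lexx t) wt.
rewrite -/u => /le_trans; apply; set Q := 4 * (C * 2 ^+ m.+2).
have Q0 : 0 <= Q by rewrite mulr_ge0 // mulr_ge0 // exprn_ge0.
have -> : 4 * (C * (2 * t) ^+ m.+2) * rnorm w / t = Q * (t ^+ m.+1 * rnorm w).
  by rewrite /Q exprMn [t ^+ m.+2]exprS; field.
rewrite -[Q * A * _]mulrA ler_wpM2l // [t ^+ m.+3]exprS mulrCA.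
rewrite ler_pM ?exprn_ge0 ?rnorm_ge0 // exprS ler_piMr // exprn_ile1 //; lra.
Qed.

(** By induction [u] is small to every order. The displacement of the [k]-th iterate is bounded by
    [2] for all [k], so Schwarz bounds it by [C * |x| ^ (m + 2)] with [C] independent of [k]. It
    equals [k * u x] up to [O(|x| ^ (m + 3))]; dividing by a large [k] raises the order of [u]. *)
Lemma cartan_uniqueness : (forall v, 'd h 0 v = v) ->
  forall x, unit_ball E x -> h x = x.
Proof.
move=> dh x x1; apply/eqP; rewrite -subr_eq0 -/(u x); apply/eqP.
have u_holo := iter_sub_holomorphic 1; have u_bnd := iter_sub_bound 1.
apply: (ball_identity u_holo u_bnd) x1; elim=> [e e0|m IH e e0].
  have h0d : differentiable h 0 by apply: h_holo; rewrite unit_ballE rnorm0.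
  have [d d0 dP] := differentiable_rnorm h0d e0; exists d => // y yd.
  by have := dP y; rewrite !subr0 h_0 subr0 dh expr1; apply.
pose C : R := 3 * 2 ^+ m.+2 * 2.
have C0 : 0 <= C by rewrite mulr_ge0 // mulr_ge0 // exprn_ge0.
have uC y : rnorm y <= 1 / 2 -> rnorm (u y) <= C * rnorm y ^+ m.+2.
  exact: half_ball_schwarz.
(* This makes [C / k] at most [e / 2]; the other half of [e] absorbs the remainder [B * |y| / k]. *)
pose k := (Num.truncn (2 * C / e)).+1.
have k0 : 0 < k%:R :> R by rewrite ltr0n.
have kC : 2 * C <= e * k%:R by rewrite -ler_pdivrMl // mulrC ltW // truncnS_gt.
have [B [d [B0 d0 dP]]] := iter_expansion k C0 uC.
have Uo : small_order (fun y => iter k h y - y) m.+1.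
  move=> e' e'0; pose A := k%:R * C + B + 1.
  have A0 : 0 < A by rewrite ltr_wpDl // addr_ge0 // mulr_ge0 // ltW.
  exists (Num.min (Num.min d (1 / 2)) (e' / A)) => [|y].
    by rewrite !lt_min d0 !divr_gt0.
  rewrite !lt_min => /andP[/andP[yd y2] yA]; have t0 := rnorm_ge0 y.
  set w := iter k h y - y; rewrite -(subrK (k%:R *: u y) w).
  apply: le_trans (rnormD _ _) _; rewrite rnormZ rnorm_nat.
  have h1 := dP _ yd; have h2 := ler_wpM2l (ltW k0) (uC _ (ltW y2)).
  have p0 : 0 <= rnorm y ^+ m.+1 by rewrite exprn_ge0.
  move: h1 h2; rewrite -/w !(exprS _ m.+2) !(exprS _ m.+1).
  move: yA; rewrite ltr_pdivlMr // /A.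
  set s := rnorm y in t0 y2 p0 *; set p := s ^+ m.+1 in p0 *.
  move=> yA h1 h2; apply: le_trans (lerD h1 h2) _.
  have -> : B * (s * (s * p)) + k%:R * (C * (s * p)) =
      s * (k%:R * C + B * s) * p by ring.
  rewrite ler_wpM2r //; have : B * s <= B by rewrite ler_piMr //; lra.
  nra.
have UC := half_ball_schwarz (iter_sub_holomorphic k) (iter_sub_bound k) Uo.
exists (Num.min (Num.min d (1 / 2)) (e * k%:R / (2 * (B + 1)))) => [|y].
  rewrite !lt_min d0 !divr_gt0 // ?mulr_gt0 // ?mulr_gt0 //; lra.
rewrite !lt_min => /andP[/andP[yd y2]].
rewrite ltr_pdivlMr ?mulr_gt0 ?ltr_wpDl // => yB.
have h1 := UC y (ltW y2); have h2 := dP y yd.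
rewrite -(ler_pM2l k0) -{1}(rnorm_nat (R := R) k) -rnormZ -/(u y).
have -> : k%:R *: u y = iter k h y - y - (iter k h y - y - k%:R *: u y).
  by rewrite subKr.
apply: le_trans (rnormB _ _) _; apply: le_trans (lerD h1 h2) _.
rewrite -/C [_ ^+ m.+3]exprS [B * _]mulrA -mulrDl [_ * (e * _)]mulrA.
rewrite ler_wpM2r ?exprn_ge0 ?rnorm_ge0 //.
have := rnorm_ge0 y; nra.
Qed.

End Cartan.

(** * Linear isometries and projections of norm 1 *)

Section LinearIsometries.
Context {R : realType}.
Implicit Types E F : completeNormedModType R[i].

Lemma closure_rnormP E (P : set E) (x : E) :
  closure P x <-> forall e : R, 0 < e -> exists2 y, P y & rnorm (y - x) < e.
Proof.
split=> [Px e e0|Px B /nbhs_rnormP[e e0 eB]].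
  have [|y [Py yx]] := Px [set y | rnorm (y - x) < e]; last by exists y.
  by apply/nbhs_rnormP; exists e.
by have [y Py yx] := Px e e0; exists y; split => //; apply: eB.
Qed.

Lemma contraction_continuous E F (g : {linear E -> F}) :
  (forall x, rnorm (g x) <= rnorm x) -> continuous g.
Proof.
move=> g1 x B /nbhs_rnormP[e e0 eB]; apply/nbhs_rnormP; exists e => // y yx.
by apply: eB; rewrite -linearB (le_lt_trans (g1 _)).
Qed.

(** Preimages of better and better approximations of [y] form a Cauchy sequence, since [A] preserves
    distances; completeness of [E] provides the limit. *)
Lemma isometry_closed_range E F (A : {linear E -> F}) :
  (forall x, rnorm (A x) = rnorm x) -> closed (range A).
Proof.
move=> A1 y /closure_rnormP Ay.
have inv0 n : (0 : R) < n.+1%:R^-1 by rewrite invr_gt0 ltr0n.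
have /choice[u uP] : forall n, exists x, rnorm (A x - y) < n.+1%:R^-1.
  by move=> n; have [_ [x _ <-] xy] := Ay _ (inv0 n); exists x.
have inv_le m n : (m <= n)%N -> (n.+1%:R^-1 : R) <= m.+1%:R^-1.
  by move=> mn; rewrite lef_pV2 ?posrE ?ltr0n // ler_nat.
have arch e : 0 < e -> exists N, N.+1%:R^-1 < e :> R.
  move=> e0; exists (Num.truncn e^-1).
  by rewrite invf_plt ?posrE ?ltr0n // truncnS_gt.
have uc : cvg (u @ \oo).
  apply: cauchy_cvg; apply: cauchy_exP => e e0.
  have eE : e = (complex.Re e)%:C by rewrite RRe_real // gtr0_real.
  have e'0 : 0 < complex.Re e / 2 by rewrite divr_gt0 // -ltcR -eE.
  have [N Ne] := arch _ e'0; exists (u N); exists N => // n /= Nn.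
  rewrite -ball_normE /= eE rnorm_lt -A1 linearB /=.
  have := uP N; have := uP n; have := inv_le _ _ Nn.
  have := rnormB (A (u N) - y) (A (u n) - y); rewrite opprB subrKA.
  move: Ne; move: (N.+1%:R^-1) (n.+1%:R^-1) => a b; lra.
exists (lim (u @ \oo)) => //; set x := lim _.
apply/eqP; rewrite -subr_eq0 -rnorm_eq0 eq_le rnorm_ge0 andbT.
apply/ler_addgt0Pr => e e0; rewrite add0r.
have e2 : 0 < e / 2 by rewrite divr_gt0.
have [N Ne] := arch _ e2.
have [M _ MP] : \forall n \near \oo, rnorm (u n - x) < e / 2.
  have : nbhs x [set z | rnorm (z - x) < e / 2].
    by apply/nbhs_rnormP; exists (e / 2).
  exact: uc.
have := MP _ (leq_maxl M N); set n := maxn M N => /= nx.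
have := le_lt_trans (inv_le _ n (leq_maxr M N)) Ne.
have := uP n; move: nx; rewrite -A1 linearB /= rdistC.
have := rnormD (A x - A (u n)) (A (u n) - y); rewrite subrKA.
by move: (n.+1%:R^-1) => b; lra.
Qed.

Lemma isometry_factor E F (A : {linear E -> F}) (p : {linear F -> F}) :
  (forall x, rnorm (A x) = rnorm x) -> range p = range A ->
  exists g : {linear F -> E}, forall y, A (g y) = p y.
Proof.
move=> A1 pA.
have Ainj x y : A x = A y -> x = y.
  move=> Axy; apply/eqP; rewrite -subr_eq0 -rnorm_eq0 -A1 linearB /= Axy.
  by rewrite subrr rnorm0.
have /choice[g gP] : forall y, exists x, A x = p y.
  move=> y; have : range p (p y) by exists y.
  by rewrite pA => -[x _ <-]; exists x.
have g_lin : linear g.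
  by move=> a x y; apply: Ainj; rewrite linearP !gP linearP.
pose g' : {linear F -> E} := HB.pack g (GRing.isLinear.Build _ _ _ _ g g_lin).
by exists g'.
Qed.

Lemma unit_ball_open E : open (unit_ball E).
Proof.
rewrite openE => x /=; rewrite unit_ballE => x1; apply/nbhs_rnormP.
exists (1 - rnorm x) => [|y yx]; first by rewrite subr_gt0.
by rewrite unit_ballE; have := rnorm_triB y x; lra.
Qed.

(** The value [1] rules out the conventional supremum [0] of an unbounded set, so the supremum is a
    genuine bound. *)
Lemma operator_norm1_le E (p : {linear E -> E}) :
  operator_norm p = 1 -> forall x, rnorm (p x) <= rnorm x.
Proof.
move=> p1 x; have [->|x0] := eqVneq x 0; first by rewrite linear0.
have xp : 0 < rnorm x by rewrite rnorm_gt0.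
have ub : has_sup [set complex.Re `|p x| | x in [set x : E | `|x| <= 1]].
  apply: contrapT => /sup_out; rewrite -/(operator_norm p) p1 => /eqP.
  by rewrite oner_eq0.
pose t : R[i] := (rnorm x)^-1%:C.
have tx : rnorm t * rnorm x = 1.
  by rewrite rnormC ger0_norm ?invr_ge0 ?ltW // mulVf // gt_eqF.
have tp : 0 < rnorm t by rewrite rnormC normr_gt0 invr_eq0 gt_eqF.
have : rnorm (p (t *: x)) <= 1.
  rewrite -p1; apply: sup_upper_bound => //; exists (t *: x) => //=.
  by rewrite -(rmorph1 (real_complex R)) rnorm_le rnormZ tx.
by rewrite linearZ /= rnormZ -tx ler_pM2l.
Qed.

Lemma operator_norm_eq1 E (p : {linear E -> E}) (x : E) :
  (forall x, rnorm (p x) <= rnorm x) -> x != 0 -> p x = x ->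
  operator_norm p = 1.
Proof.
move=> p1 x0 px; have xp : 0 < rnorm x by rewrite rnorm_gt0.
pose t : R[i] := (rnorm x)^-1%:C.
have tx : rnorm (t *: x) = 1.
  by rewrite rnormZ rnormC ger0_norm ?invr_ge0 ?ltW // mulVf // gt_eqF.
have in1 (y : E) : (`|y| <= 1) = (rnorm y <= 1).
  by rewrite -(rmorph1 (real_complex R)) rnorm_le.
have attained : [set complex.Re `|p x| | x in [set x : E | `|x| <= 1]] 1.
  by exists (t *: x); rewrite /= ?in1 ?tx // linearZ /= px -/(rnorm _).
have ub : ubound [set complex.Re `|p x| | x in [set x : E | `|x| <= 1]] 1.
  by move=> _ [y + <-]; rewrite /= in1 => /(le_trans (p1 y)).
apply/eqP; rewrite eq_le; apply/andP; split.
  by apply: ge_sup => //; exists 1.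
by apply: sup_upper_bound => //; split; exists 1.
Qed.

Lemma small_order0 E F (f : E -> F) : differentiable f 0 -> f 0 = 0 ->
  small_order f 0.
Proof.
move=> fd f0 e e0.
have [d d0 dP] := continuous_rnorm (differentiable_continuous fd) e0.
exists d => // x; have := dP x; rewrite f0 !subr0 expr0 mulr1 => h /h.
exact: ltW.
Qed.

(** Schwarz's estimate of order [0] gives [|f (t v)| <= t |v| / (rho - t |v|)]; divide by [t], with
    [t] small and [rho] close to [1]. *)
Lemma schwarz_differential E F (f : E -> F) :
  holomorphic (unit_ball E) f ->
  (forall x, unit_ball E x -> unit_ball F (f x)) -> f 0 = 0 ->
  forall v, rnorm ('d f 0 v) <= rnorm v.
Proof.
move=> fd fb f0 v; set n := rnorm v.
have f0d : differentiable f 0 by apply: fd; rewrite unit_ballE rnorm0.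
have [->|v0] := eqVneq v 0; first by rewrite linear0 rnorm0 rnorm_ge0.
have np : 0 < n by rewrite rnorm_gt0.
have f1 x : unit_ball E x -> rnorm (f x) <= 1.
  by move=> /fb; rewrite unit_ballE => /ltW.
apply/ler_addgt0Pr => e e0.
have en : 0 < e / (2 * n) by rewrite divr_gt0 // mulr_gt0.
have [d d0 dP] := differentiable_rnorm f0d en.
(* Chosen so that [n / s = n + e / 2]: the choice of [t] ensures [rho - t * n >= s]. The other
   [e / 2] is the error of the differential. *)
pose s := n / (n + e / 2).
have ne : 0 < n + e / 2 by lra.
have s1 : s < 1 by rewrite ltr_pdivrMr //; lra.
have s0 : 0 < s by rewrite divr_gt0.
pose rho := (s + 1) / 2.
pose t := Num.min (d / 2) (rho - s) / n.
have t0 : 0 < t by rewrite divr_gt0 // lt_min /rho; apply/andP; split; lra.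
have tn : t * n <= rho - s by rewrite /t divfK ?gt_eqF // ge_min lexx orbT.
have td : t * n < d by rewrite /t divfK ?gt_eqF // gt_min; apply/orP; left; lra.
have tvE : rnorm (t%:C *: v) = t * n by rewrite rnormZ rnormC ger0_norm // ltW.
have := dP (t%:C *: v); rewrite f0 !subr0 tvE => /(_ td) h1.
have tr : rnorm (t%:C *: v) < rho < 1.
  by rewrite tvE; apply/andP; split; rewrite /rho in tn *; lra.
have := ball_schwarz fd f1 (small_order0 f0d f0) tr.
rewrite tvE expr1 mul1r => h2.
have rt : 0 < rho - t * n by lra.
have h3 : t * n / rho * (rho / (rho - t * n)) <= t * (n + e / 2).
  have -> : t * n / rho * (rho / (rho - t * n)) = t * (n / (rho - t * n)).
    by field; rewrite !gt_eqF // /rho; lra.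
  rewrite ler_pM2l // ler_pdivrMr // -ler_pdivrMl // mulrC -/s; lra.
have := rnorm_triB ('d f 0 (t%:C *: v)) (f (t%:C *: v)).
rewrite rdistC linearZ /= rnormZ rnormC (ger0_norm (ltW t0)) => h4.
rewrite -(ler_pM2l t0); move: h1 h2 h3 h4.
have -> : e / (2 * n) * (t * n) = t * (e / 2) by field; rewrite gt_eqF.
rewrite linearZ /=; lra.
Qed.

End LinearIsometries.

(** * The two implications of the equivalence *)

Section Retraction.
Context {R : realType} {E1 E2 : completeNormedModType R[i]}.
Variable f : E1 -> E2.
Hypothesis f_ball : forall x, unit_ball E1 x -> unit_ball E2 (f x).
Hypothesis f_holo : holomorphic (unit_ball E1) f.
Hypothesis f_0 : f 0 = 0.
Hypothesis df_isometry : forall X : E1, rnorm ('d f 0 X) = rnorm X.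

Let A := 'd f 0.
Let M := f @` unit_ball E1.

Let ball0 (E : completeNormedModType R[i]) : unit_ball E 0.
Proof. by rewrite unit_ballE rnorm0. Qed.

Let f_d0 : differentiable f 0.
Proof. exact/f_holo/ball0. Qed.

Section FromProjection.
Variables (F : set E2) (p : {linear E2 -> E2}).
Hypothesis dec : direct_decomposition (range A) F.
Hypothesis p_proj : projection_onto_along p (range A) F.
Hypothesis p_norm : operator_norm p = 1.

Lemma left_inverse_of_projection : exists g : {linear E2 -> E1},
  [/\ continuous g, forall y, rnorm (g y) <= rnorm y, forall x, g (A x) = x
    & forall x, unit_ball E1 x -> g (f x) = x].
Proof.
have [p_cont pp pA _] := p_proj.
have [g gP] := isometry_factor df_isometry pA.
have g1 y : rnorm (g y) <= rnorm y.
  by rewrite -df_isometry gP operator_norm1_le.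
have gA x : g (A x) = x.
  have : range p (A x) by rewrite pA; exists x.
  move=> [z _ pz]; apply/eqP; rewrite -subr_eq0 -rnorm_eq0 -df_isometry.
  by rewrite linearB /= gP -/A -pz pp subrr rnorm0.
have gc := contraction_continuous g1.
have gball y : unit_ball E2 y -> unit_ball E1 (g y).
  by rewrite !unit_ballE; apply: le_lt_trans.
have gd y : differentiable g y by apply: linear_differentiable.
exists g; split=> // x x1.
apply: (@cartan_uniqueness _ _ (g \o f)) x1.
- by move=> y y1; apply: differentiable_comp => //; apply: f_holo.
- by move=> y /f_ball/gball.
- by rewrite /= f_0 linear0.
- by move=> v; rewrite diff_comp //= diff_lin //= -/A gA.
Qed.

Lemma submanifold_of_projection :
  [/\ closed_direct_submanifold (unit_ball E2) M,
      biholomorphism_onto_submanifold (unit_ball E1) (unit_ball E2) M f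
    & exists r : E2 -> E2, holomorphic_retraction (unit_ball E2) M r].
Proof.
have [g [gc g1 gA gf]] := left_inverse_of_projection.
have gball y : unit_ball E2 y -> unit_ball E1 (g y).
  by rewrite !unit_ballE; apply: le_lt_trans.
have gd y : differentiable g y by apply: linear_differentiable.
have Ac : continuous A by apply: diff_continuous.
have Ad x : differentiable A x by apply: linear_differentiable.
have MU y : M y -> unit_ball E2 y by move=> [x /f_ball + <-].
have fg y : M y -> f (g y) = y by move=> [x x1 <-]; rewrite gf.
have Mfg y : unit_ball E2 y -> f (g y) = y -> M y.
  by move=> /gball gy yE; exists (g y).
have r_holo : holomorphic (unit_ball E2) (f \o g).
  by move=> y /gball gy; apply: differentiable_comp => //; apply: f_holo.
split.
- split.
    (* Within the ball, [M] is the fixed-point set of the continuous map [f \o g], hence relatively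
       closed. *)
    exists (closure M); first exact: closed_closure.
    apply/seteqP; split=> [y My|y [y1 /closure_rnormP yM]].
      by split; [exact: MU | exact: subset_closure].
    apply: Mfg => //; apply/eqP; rewrite -subr_eq0 -rnorm_eq0 eq_le rnorm_ge0 andbT.
    apply/ler_addgt0Pr => e e0; rewrite add0r.
    have e2 : 0 < e / 2 by rewrite divr_gt0.
    have [d d0 dP] := continuous_rnorm (differentiable_continuous (r_holo _ y1)) e2.
    have de0 : 0 < Num.min d (e / 2) by rewrite lt_min d0.
    have [z Mz] := yM _ de0; rewrite lt_min => /andP[/dP /= + ze].
    rewrite fg // rdistC => h; have := rnormD (f (g y) - z) (z - y).
    rewrite subrKA; lra.
  move=> q Mq; pose phi' x := f x - A x.
  (* The correction takes values in the kernel of [g], so [phi] and [psi] both preserve [g]; adding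
     the correction back therefore inverts subtracting it. *)
  have phi'g x : unit_ball E1 x -> g (phi' x) = 0.
    by move=> x1; rewrite /phi' linearB /= gf // gA subrr.
  pose phi y := y - phi' (g y); pose psi z := z + phi' (g z).
  pose V := [set z | unit_ball E1 (g z) /\ unit_ball E2 (psi z)].
  have phi'd x : unit_ball E1 x -> differentiable phi' x.
    by move=> x1; apply: differentiableB => //; apply: f_holo.
  have phi'gd y : unit_ball E1 (g y) -> differentiable (phi' \o g) y.
    by move=> gy; apply: differentiable_comp => //; apply: phi'd.
  have idd y : differentiable (@id E2) y by apply: ex_diff.
  have psid z : unit_ball E1 (g z) -> differentiable psi z.
    by move=> gz; apply: (@differentiableD _ _ _ id (phi' \o g)) => //; apply: phi'gd.
  have phid y : unit_ball E2 y -> differentiable phi y.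
    move=> /gball gy; apply: (@differentiableB _ _ _ id (phi' \o g)) => //.
    exact: phi'gd.
  have gphi y : unit_ball E2 y -> g (phi y) = g y.
    by move=> /gball gy; rewrite /phi linearB /= phi'g // subr0.
  have gpsi z : V z -> g (psi z) = g z.
    by move=> [gz _]; rewrite /psi linearD /= phi'g // addr0.
  have psiphi y : unit_ball E2 y -> psi (phi y) = y.
    by move=> y1; rewrite /psi gphi // /phi subrK.
  have phipsi z : V z -> phi (psi z) = z.
    by move=> Vz; rewrite /phi gpsi // /psi addrK.
  have phiV y : unit_ball E2 y -> V (phi y).
    by move=> y1; split; [rewrite gphi //; exact: gball | rewrite psiphi].
  have openV : open V.
    rewrite openE => z [gz pz]; apply: filterI.
      by apply: gc; apply: open_nbhs_nbhs; split=> //; exact: unit_ball_open.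
    apply: (differentiable_continuous (psid _ gz)).
    by apply: open_nbhs_nbhs; split=> //; exact: unit_ball_open.
  exists (unit_ball E2), V, phi, psi, (range A); split; first exact: MU.
  split.
  + by [].
  + split.
    * by split=> //; exact: unit_ball_open.
    * by split=> [y /phid|z [gz _]] //; apply: psid.
    * by split=> [y /phiV|z [_ pz]].
    * by move=> y; rewrite inE => /psiphi.
    * by move=> z; rewrite inE => /phipsi.
  + by have [] := dec.
  + by exists F.
  + apply/seteqP; split=> [_ [y [y1 My] <-]|z [Vz [x _ xz]]].
      split; first exact: phiV.
      by exists (g y) => //; rewrite /phi /phi' fg // subKr.
    have [gz pz] := Vz; exists (psi z); last exact: phipsi.
    split=> //; apply: Mfg => //; rewrite gpsi // /psi /phi' -xz gA addrC.
    by rewrite subrK.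
- exists g; split.
  + split.
    * by move=> x x1; exists x.
    * by move=> x; rewrite inE => x1; apply/differentiable_continuous/f_holo.
    * move=> W V phi psi L [_ [[_ _] [phid _] _ _ _] _ _ _] x [x1 fx].
      by apply: differentiable_comp; [exact: f_holo | exact: phid].
  + split; first by move=> _ [x x1 <-]; rewrite gf.
    move=> W V phi psi L [_ [_ [_ psid] _ _ _] _ _ _] y [Vy Ly].
    have d : differentiable (g \o psi) y.
      by apply: differentiable_comp => //; apply: psid.
    exists ('d (g \o psi) y); split.
    * by apply: continuous_subspaceT; apply: diff_continuous.
    * by move=> c u v _ _; rewrite linearP.
    * apply/eqoP => e e0; have eE : e = (complex.Re e)%:C.
        by rewrite RRe_real // gtr0_real.
      have e'0 : 0 < complex.Re e by rewrite -ltcR -eE.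
      have [dl dl0 dP] := differentiable_rnorm d e'0.
      apply: cvg_within; apply/nbhs_rnormP; exists dl => // z /dP.
      by rewrite eE !normE -rmorphM lecR.
  + by move=> x; rewrite inE => /gf.
  + by move=> y; rewrite inE => /fg.
- exists (f \o g); split=> //.
  + by move=> y /gball/f_ball.
  + apply/seteqP; split=> [_ [y /gball gy <-]|_ [x x1 <-]].
      by exists (g y).
    by exists (f x); [exact: f_ball | rewrite /= gf].
Qed.

End FromProjection.

Section FromRetraction.
Variables (g : E2 -> E1) (r : E2 -> E2).
Hypothesis M_sub : closed_direct_submanifold (unit_ball E2) M.
Hypothesis g_holo :
  holomorphic_from_submanifold (unit_ball E2) M (unit_ball E1) g.
Hypothesis gf : {in unit_ball E1, cancel f g}.
Hypothesis fg : {in M, cancel g f}.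
Hypothesis r_retr : holomorphic_retraction (unit_ball E2) M r.

(** Near [0] in [M], [g] is [g \o psi] after [phi] for a chart at [0]. Differentiability of
    [g \o psi] within [L] gives continuity there, and [phi] is continuous. *)
Lemma inverse_small_at0 (e : R) : 0 < e -> exists2 d : R, 0 < d &
  forall y, M y -> rnorm y < d -> rnorm (g y) < e.
Proof.
move=> e0; have M0 : M 0 by exists 0.
have g0 : g 0 = 0 by rewrite -{1}f_0 gf // inE.
have [_ chart] := M_sub; have [W [V [phi [psi [L [W0 Wch]]]]]] := chart 0 M0.
have [_ gchart] := g_holo; have gpsi := gchart _ _ _ _ _ Wch.
case: Wch => WU [[Wo _] [phid _] _ phiK _] [_ [L0 LS]] _ phiM.
have phiMW y : W y -> M y -> (V `&` L) (phi y).
  by move=> Wy My; rewrite -phiM; exists y.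
set a := phi 0; have [D [Dc Dlin Do]] := gpsi a (phiMW _ W0 M0).
have {}L0 : L 0 by move: L0; rewrite inE.
have La : L a by have [] := phiMW _ W0 M0.
have D0 : D 0 = 0.
  have := Dlin 1 0 0 L0 L0; rewrite scaler0 addr0 scale1r => /eqP.
  by rewrite -subr_eq0 opprD addNKr oppr_eq0 => /eqP.
have subL x y : L x -> L y -> L (y - x).
  move=> Lx Ly; have := LS (-1) x y; rewrite !inE scaleN1r addrC; exact.
move: Do => /eqoP /(_ 1 ltr01) /nbhs_rnormP[d1 d10 d1P].
have e2 : 0 < e / 2 by rewrite divr_gt0.
have [d2 d20 d2P] : exists2 d : R, 0 < d & forall z, rnorm (z - 0) < d -> L z ->
    rnorm (D z - D 0) < e / 2.
  apply/nbhs_rnormP; have D0c := (subspace_continuousP L D).1 Dc _ L0.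
  have : nbhs (D 0) [set z | rnorm (z - D 0) < e / 2].
    by apply/nbhs_rnormP; exists (e / 2).
  exact: D0c.
have m0 : 0 < Num.min (Num.min d1 d2) (e / 2) by rewrite !lt_min d10 d20.
have [d3 d30 d3P] :=
  continuous_rnorm (differentiable_continuous (phid _ W0)) m0.
have [d4 d40 d4P] : exists2 d : R, 0 < d & forall y, rnorm (y - 0) < d -> W y.
  by apply/nbhs_rnormP; apply: open_nbhs_nbhs.
exists (Num.min d3 d4) => [|y My]; first by rewrite lt_min d30.
rewrite lt_min -{1 2}(subr0 y) => /andP[/d3P + /d4P Wy].
rewrite !lt_min => /andP[/andP[ya1 ya2] yae].
have [_ Ly] := phiMW _ Wy My.
have psiphi z : W z -> psi (phi z) = z by move=> Wz; rewrite phiK // inE.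
have := d1P _ ya1 Ly; rewrite /= psiphi // /a psiphi // g0 subr0 mul1r.
rewrite !normE lecR -/a => h1.
have := d2P (phi y - a); rewrite subr0 D0 subr0 => /(_ ya2 (subL _ _ La Ly)) h2.
have := rnorm_triB (g y) (D (phi y - a)); lra.
Qed.

Lemma projection_of_retraction : (exists x : E1, x != 0) ->
  exists F : set E2, direct_decomposition (range A) F /\
    exists p : {linear E2 -> E2},
      projection_onto_along p (range A) F /\ operator_norm p = 1.
Proof.
move=> [x0 x0n]; have [r_holo r_ball rM r_id] := r_retr.
have r0 : r 0 = 0 by apply: r_id; exists 0.
have rd : differentiable r 0 by exact/r_holo/ball0.
pose p : {linear E2 -> E2} := 'd r 0.
have pc : continuous p by apply: diff_continuous.
have p1 x : rnorm (p x) <= rnorm x by apply: schwarz_differential.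
have rf x : unit_ball E1 x -> r (f x) = f x by move=> x1; apply: r_id; exists x.
(* [r \o f] and [f] agree near [0]; passing to directional derivatives, which see only germs, lets
   the chain rule conclude. *)
have pA x : p (A x) = A x.
  have drf : differentiable r (f 0) by rewrite f_0.
  have dc : 'd (r \o f) 0 x = 'd r (f 0) ('d f 0 x).
    exact: (congr1 (fun k : E1 -> E2 => k x) (diff_comp f_d0 drf)).
  rewrite f_0 in dc; rewrite -[LHS]dc -[RHS](deriveE _ f_d0).
  rewrite -(deriveE _ (differentiable_comp f_d0 drf)); apply: near_eq_derive.
  by apply/nbhs_rnormP; exists 1 => // y; rewrite subr0 -unit_ballE => /rf.
have cl : closed (range A) := isometry_closed_range df_isometry.
(* For small [t], write [r (t v) = f x]. Continuity of the inverse makes [x] small, so [t *: p v]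
   and [A x] differ by [o(t)], and [p v] is a limit of the vectors [A (x / t)]. *)
have pR v : range A (p v).
  apply: cl; apply/closure_rnormP => e e0.
  pose n := rnorm v + 1; have n0 : 0 < n by rewrite ltr_wpDl ?rnorm_ge0.
  have en k : 0 < k -> 0 < e / (k * n) by move=> k0; rewrite divr_gt0 // mulr_gt0.
  (* The bounds [1 / 2] and [1] yield [|r y| <= 2 * tn] and [|x| <= 4 * tn]; the other two then make
     the errors at most [t * e / 4] and [t * e / 2]. *)
  have eta0 : 0 < Num.min (1 / 2) (e / (16 * n)) by rewrite lt_min divr_gt0 //= en.
  have eps0 : 0 < Num.min 1 (e / (2 * n)) by rewrite lt_min ltr01 en.
  have [d d0 dP] := differentiable_rnorm f_d0 eta0.
  have [d1 d10 d1P] := inverse_small_at0 d0.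
  have [d2 d20 d2P] := differentiable_rnorm rd eps0.
  pose tn := Num.min (Num.min (d1 / 4) (d2 / 2)) (1 / 2).
  have tn0 : 0 < tn by rewrite !lt_min !divr_gt0.
  pose t := tn / n; have t0 : 0 < t by rewrite divr_gt0.
  have [tn1 tn2 tn3] : [/\ tn <= d1 / 4, tn <= d2 / 2 & tn <= 1 / 2].
    by split; rewrite /tn !ge_min lexx ?orbT.
  pose y := t%:C *: v.
  have yn : rnorm y <= tn.
    rewrite /y rnormZ rnormC (ger0_norm (ltW t0)).
    rewrite -[leRHS](divfK (lt0r_neq0 n0)) -/t ler_wpM2l ?(ltW t0) //.
    by rewrite /n lerDl.
  have y1 : unit_ball E2 y by rewrite unit_ballE; lra.
  have Mry : M (r y) by rewrite -rM; exists y.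
  pose x := g (r y); have fx : f x = r y by rewrite /x fg // inE.
  have := d2P y; rewrite r0 !subr0 => h1.
  have {}h1 : rnorm (r y - p y) <= Num.min 1 (e / (2 * n)) * rnorm y by apply: h1; lra.
  have ry : rnorm (r y) <= 2 * tn.
    have := rnorm_triB (r y) (p y); have := p1 y; have := rnorm_ge0 y.
    have : Num.min 1 (e / (2 * n)) <= 1 by rewrite ge_min lexx.
    nra.
  have xd : rnorm x < d by apply: d1P => //; lra.
  have := dP x; rewrite f_0 !subr0 -/A => /(_ xd) h2.
  have xn : rnorm x <= 4 * tn.
    have := rnorm_triB (A x) (f x); rewrite df_isometry rdistC fx in h2 *.
    have : Num.min (1 / 2) (e / (16 * n)) <= 1 / 2 by rewrite ge_min lexx.
    have := rnorm_ge0 x; nra.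
  exists (A ((t^-1)%:C *: x)); first by exists ((t^-1)%:C *: x).
  have -> : A ((t^-1)%:C *: x) - p v = (t^-1)%:C *: (A x - p y).
    have -> : A ((t^-1)%:C *: x) = (t^-1)%:C *: A x by exact: linearZ.
    have -> : p y = t%:C *: p v by exact: linearZ.
    rewrite [RHS]scalerBr [in RHS]scalerA -rmorphM /= mulVf ?scale1r //.
    exact: lt0r_neq0.
  rewrite rnormZ rnormC ger0_norm ?invr_ge0 ?(ltW t0) // ltr_pdivrMl //.
  have -> : A x - p y = (A x - f x) + (r y - p y) by rewrite fx subrKA.
  apply: le_lt_trans (rnormD _ _) _; rewrite rdistC.
  have tE : t * e = e * tn / n by rewrite /t; ring.
  have b1 : Num.min (1 / 2) (e / (16 * n)) * rnorm x <= e * tn / n / 4.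
    have -> : e * tn / n / 4 = e / (16 * n) * (4 * tn) by field; rewrite gt_eqF.
    by rewrite ler_pM ?rnorm_ge0 ?(ltW eta0) // ge_min lexx orbT.
  have b2 : Num.min 1 (e / (2 * n)) * rnorm y <= e * tn / n / 2.
    have -> : e * tn / n / 2 = e / (2 * n) * tn by field; rewrite gt_eqF.
    by rewrite ler_pM ?rnorm_ge0 ?(ltW eps0) // ge_min lexx orbT.
  have : 0 < e * tn / n by rewrite divr_gt0 // mulr_gt0.
  rewrite tE; lra.
have pp x : p (p x) = p x by have [z _ <-] := pR x; rewrite pA.
have rangep : range p = range A.
  apply/seteqP; split=> [_ [v _ <-]|_ [x _ <-]]; first exact: pR.
  by exists (A x).
exists (p @^-1` [set 0]); split; last first.
  exists p; split; first by split.
  (* A nonzero fixed vector is what makes the norm [1]: for a trivial [E1] the projection would be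
     zero, of norm [0]. *)
  apply: (@operator_norm_eq1 _ _ _ (A x0)) => //.
  by rewrite -rnorm_eq0 df_isometry rnorm_eq0.
split.
- split=> //; split; first by rewrite inE; exists 0 => //; rewrite linear0.
  move=> a u v; rewrite !inE => -[x _ <-] [y _ <-].
  by exists (a *: x + y) => //; rewrite linearP.
- split.
    move=> y /closure_rnormP yK; apply/eqP; rewrite -rnorm_eq0 eq_le rnorm_ge0.
    rewrite andbT; apply/ler_addgt0Pr => e e0; rewrite add0r.
    have [z pz zy] := yK e e0; have pzy : p (z - y) = - p y.
      by rewrite linearB /= pz sub0r.
    by rewrite -rnormN -pzy (le_trans (p1 _)) // ltW.
  split; first by rewrite inE /= linear0.
  by move=> a u v; rewrite !inE /= linearP => -> ->; rewrite scaler0 addr0.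
- apply/seteqP; split=> [_ [[x _ <-] /= pAx0]|_ ->].
    by rewrite -pA.
  by split; [exists 0; rewrite ?linear0 | rewrite /= linear0].
- apply/seteqP; split=> // x _; exists (p x); first exact: pR.
  exists (x - p x); last by rewrite subrKC.
  by rewrite /= linearB /= pp subrr.
Qed.

End FromRetraction.

End Retraction.

Theorem theorem1 (R : realType) (E1 E2 : completeNormedModType R[i])
    (E1_neq0 : exists x : E1, x != 0)
    (f : E1 -> E2)
    (f_ball : forall x, unit_ball E1 x -> unit_ball E2 (f x))
    (f_holo : holomorphic (unit_ball E1) f)
    (f_0 : f 0 = 0)
    (df_isometry : forall X : E1, `|'d f 0 X| = `|X|) :
  (exists F : set E2,
     direct_decomposition (range ('d f 0)) F /\
     exists p : {linear E2 -> E2},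
       projection_onto_along p (range ('d f 0)) F /\ operator_norm p = 1)
  <->
  [/\ closed_direct_submanifold (unit_ball E2) (f @` unit_ball E1),
      biholomorphism_onto_submanifold (unit_ball E1) (unit_ball E2)
        (f @` unit_ball E1) f
    & exists r : E2 -> E2,
        holomorphic_retraction (unit_ball E2) (f @` unit_ball E1) r].
Proof.
have df_rnorm X : rnorm ('d f 0 X) = rnorm X by rewrite /rnorm df_isometry.
split=> [[F [dec [p [p_proj p_norm]]]]|[M_sub [g [_ g_holo gf fg]] [r r_retr]]].
  exact: submanifold_of_projection dec p_proj p_norm.
exact: projection_of_retraction M_sub g_holo gf fg r_retr E1_neq0.
Qed.
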